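(* Let $u_1,\dots,u_m\in\mathbb{R}^3$ be the radius vectors of the vertices of a Platonic solid centered at the origin, and let $\Delta$ be the Laplace operator on $\mathbb{R}^3$. Below, $C$ denotes a nonzero constant, possibly different at each occurrence. (a) Tetrahedron ($m=4$): $e_1(\mathcal{D}_{u_1},\dots,\mathcal{D}_{u_4})=0$ and $e_2(\mathcal{D}_{u_1},\dots,\mathcal{D}_{u_4})=C\Delta$. (b) Octahedron ($m=6$): $e_2(\mathcal{D}_{u_1},\dots,\mathcal{D}_{u_6})=C\Delta$, and $e_{m-2k+1}(\mathcal{D}_{u_1},\dots,\mathcal{D}_{u_6})=0$ for all $1\le k\le m/2$. (c) Cube ($m=8$): $e_2(\mathcal{D}_{u_1},\dots,\mathcal{D}_{u_8})=C\Delta$, and $e_{m-2k+1}(\mathcal{D}_{u_1},\dots,\mathcal{D}_{u_8})=0$ for all $1\le k\le m/2$. (d) Icosahedron ($m=12$): $e_2(\mathcal{D}_{u_1},\dots,\mathcal{D}_{u_{12}})=C\Delta$, $e_4(\mathcal{D}_{u_1},\dots,\mathcal{D}_{u_{12}})=C\Delta^2$, and $e_{m-2k+1}(\mathcal{D}_{u_1},\dots,\mathcal{D}_{u_{12}})=0$ for all $1\le k\le m/2$. (e) Dodecahedron ($m=20$): $e_2(\mathcal{D}_{u_1},\dots,\mathcal{D}_{u_{20}})=C\Delta$, $e_4(\mathcal{D}_{u_1},\dots,\mathcal{D}_{u_{20}})=C\Delta^2$, and $e_{m-2k+1}(\mathcal{D}_{u_1},\dots,\mathcal{D}_{u_{20}})=0$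 for all $1\le k\le m/2$.
   Context: Here $e_r$ is the $r$-th elementary symmetric polynomial in $m$ variables and $\mathcal{D}_u=u\cdot\nabla$ is the directional derivative along $u\in\mathbb{R}^3$. Platonic solids are the regular convex polyhedra in $\mathbb{R}^3$. *)

(* Defs.v *)
From HB Require Import structures.
From mathcomp Require Import all_boot all_order all_algebra all_fingroup.
From mathcomp Require Import all_classical all_reals all_analysis.
Import Order.TTheory GRing.Theory Num.Theory.
Import numFieldNormedType.Exports.

Set Implicit Arguments.
Unset Strict Implicit.
Unset Printing Implicit Defensive.

Local Open Scope ring_scope.

(* A convex polyhedron in R^3 is given by the family u : 'I_m -> 'rV[R]_3 of
   its vertices: the polyhedron is the convex hull of the u i, and a face is
   represented by the set of the indices of the vertices it contains. *)
Section Polyhedra.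
Context {R : realType} {m : nat}.
Implicit Types (u : 'I_m -> 'rV[R]_3) (F : {set 'I_m}).

Definition dotv (x y : 'rV[R]_3) : R := (x *m y^T) 0 0.

(* The faces of a polytope are the sets on which a linear functional attains
   its maximum; a = 0 gives the whole polytope (c = 0) and the empty face
   (c > 0). *)
Definition is_face u F : Prop :=
  exists (a : 'rV[R]_3) (c : R),
    forall i, dotv a (u i) <= c /\ (i \in F <-> dotv a (u i) = c).

(* One plus the dimension of the affine hull of the points u i, i \in F: it is
   the rank of the family of homogeneous coordinates (u i, 1), i \in F. *)
Definition affine_rank u F : nat :=
  \rank (\matrix_(i < m)
           (if i \in F then row_mx (u i) (const_mx 1 : 'rV[R]_1) else 0)).

Definition face_of_dim u (d : nat) F : Prop :=
  is_face u F /\ affine_rank u F = d.+1.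

(* The second clause says that each u i is a vertex of the convex hull, and
   that u enumerates the vertices without repetition. *)
Definition vertices_of_polyhedron u : Prop :=
  affine_rank u [set: 'I_m] = 4%N /\ forall i, is_face u [set i].

(* The permutations of the vertices induced by the isometries of R^3 that
   preserve the polyhedron. *)
Definition is_symmetry u (s : {perm 'I_m}) : Prop :=
  exists (Q : 'M[R]_3) (t : 'rV[R]_3),
    Q *m Q^T = 1%:M /\ forall i, u (s i) = u i *m Q + t.

Definition is_flag u (i : 'I_m) (E F : {set 'I_m}) : Prop :=
  [/\ face_of_dim u 1 E, face_of_dim u 2 F, i \in E & E \subset F].

Definition regular_polyhedron u : Prop :=
  vertices_of_polyhedron u /\
  forall i E F i' E' F', is_flag u i E F -> is_flag u i' E' F' ->
    exists s : {perm 'I_m},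
      [/\ is_symmetry u s, s i = i', s @: E = E' & s @: F = F'].

(* Schlaefli symbol {p, q}: the 2-faces are p-gons, and q of them meet at each
   vertex. *)
Definition schlafli u (p q : nat) : Prop :=
  (forall F, face_of_dim u 2 F -> #|F| = p) /\
  (forall i, #|[set F : {set 'I_m} | `[< face_of_dim u 2 F >] & i \in F]| = q).

(* The center of a regular polyhedron is the centroid of its vertices. *)
Definition centered u : Prop := \sum_i u i = 0.

Definition platonic_solid u (p q : nat) : Prop :=
  [/\ regular_polyhedron u, schlafli u p q & centered u].

End Polyhedra.

Definition tetrahedron (R : realType) (u : 'I_4 -> 'rV[R]_3) : Prop :=
  platonic_solid u 3 3.
Definition octahedron (R : realType) (u : 'I_6 -> 'rV[R]_3) : Prop :=
  platonic_solid u 3 4.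
Definition cube (R : realType) (u : 'I_8 -> 'rV[R]_3) : Prop :=
  platonic_solid u 4 3.
Definition icosahedron (R : realType) (u : 'I_12 -> 'rV[R]_3) : Prop :=
  platonic_solid u 3 5.
Definition dodecahedron (R : realType) (u : 'I_20 -> 'rV[R]_3) : Prop :=
  platonic_solid u 5 3.

Section Operators.
Context {R : realType}.

Definition operator := ('rV[R]_3 -> R) -> 'rV[R]_3 -> R.

Fixpoint class_C (n : nat) (f : 'rV[R]_3 -> R) : Prop :=
  match n with
  | 0 => continuous f
  | k.+1 => (forall x, differentiable f x) /\ forall v, class_C k ('D_v f)
  end.

Definition smooth (f : 'rV[R]_3 -> R) : Prop := forall n, class_C n f.

(* The library's 'D_v f is total; it is the directional derivative
   x |-> v . grad f (x) at every point where f is differentiable. *)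
Definition dirD (v : 'rV[R]_3) : operator := fun f => 'D_v f.

Definition laplacian : operator :=
  fun f x => \sum_(j < 3) dirD (delta_mx 0 j) (dirD (delta_mx 0 j) f) x.

(* e_r(D_1, ..., D_m), the product of operators being composition. The
   operators dirD v commute on smooth functions, so that the order of the
   factors (increasing indices) is irrelevant there. *)
Definition elem_sym (m r : nat) (D : 'I_m -> operator) : operator :=
  fun f x => \sum_(S : {set 'I_m} | #|S| == r)
    (\big[comp/id]_(i in S) D i) f x.

(* Equalities of differential operators, as operators on C^oo(R^3). *)
Definition op_zero (A : operator) : Prop :=
  forall f, smooth f -> forall x, A f x = 0.

Definition op_proportional (A B : operator) : Prop :=
  exists C : R, C != 0 /\ forall f, smooth f -> forall x, A f x = C * B f x.

End Operators.
Arguments operator R : clear implicits.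

(* Main.v *)
(* Transitivity on flags yields three reflections of R^3 preserving the solid:
   they fix two of the three vectors (vertex, sum of the vertices of the edge,
   sum of the vertices of the facet) attached to a flag and move the third.
   Their roots n0, n1, n2 satisfy n0 . n2 = 0, and counting the orbits of a
   product of two of them on the p vertices of the facet, or on the q facets at
   the vertex, determines 4 cos^2 of the two other angles, up to the Galois
   conjugation of Q(sqrt 5), which is harmless.  Everything else is linear
   algebra with these three reflections: the second moment of the vertices is
   proportional to the Euclidean form; the product of the three reflections
   has by Cayley-Hamilton a power equal to -1 unless p = q = 3; and when p or q
   is 5 the fourth moment is proportional to the square of the Euclidean form.
   With the symmetry of second derivatives, e_r(D_1, ..., D_m) f (x) is the
   value at the polynomial e_r(u_1 . X, ..., u_m . X) of a linear functional on
   R[X_0, X_1, X_2] depending on f and x, and Newton's identities express e_2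
   and e_4 by power sums. *)
Require Import Defs.
From mathcomp Require Import all_boot all_order all_algebra all_fingroup.
From mathcomp Require Import all_classical all_reals all_analysis.
From mathcomp Require freeg mpoly.
Import (canonicals, coercions) freeg mpoly.
From mathcomp Require Import ring lra.
Import Order.TTheory GRing.Theory Num.Theory.
Import numFieldNormedType.Exports.

Set Implicit Arguments.
Unset Strict Implicit.
Unset Printing Implicit Defensive.

Local Open Scope ring_scope.

(** * Faces of a polytope *)


Section DotProduct.
Context {R : realType}.
Implicit Types (x y z : 'rV[R]_3) (a b : R).

Lemma dotvE x y : dotv x y = \sum_j x 0 j * y 0 j.
Proof. by rewrite /dotv mxE; apply: eq_bigr => j _; rewrite mxE. Qed.

Lemma dotvC x y : dotv x y = dotv y x.
Proof. by rewrite !dotvE; apply: eq_bigr => j _; rewrite mulrC. Qed.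

Lemma dotvDl x y z : dotv (x + y) z = dotv x z + dotv y z.
Proof. by rewrite /dotv mulmxDl mxE. Qed.

Lemma dotvZl a x z : dotv (a *: x) z = a * dotv x z.
Proof. by rewrite /dotv -scalemxAl mxE. Qed.

Lemma dotvNl x z : dotv (- x) z = - dotv x z.
Proof. by rewrite -scaleN1r dotvZl mulN1r. Qed.

Lemma dotvBl x y z : dotv (x - y) z = dotv x z - dotv y z.
Proof. by rewrite dotvDl dotvNl. Qed.

Lemma dotvDr x y z : dotv z (x + y) = dotv z x + dotv z y.
Proof. by rewrite dotvC dotvDl ![dotv _ z]dotvC. Qed.

Lemma dotvZr a x z : dotv z (a *: x) = a * dotv z x.
Proof. by rewrite dotvC dotvZl dotvC. Qed.

Lemma dotvNr x z : dotv z (- x) = - dotv z x.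
Proof. by rewrite dotvC dotvNl dotvC. Qed.

Lemma dotvBr x y z : dotv z (x - y) = dotv z x - dotv z y.
Proof. by rewrite dotvDr dotvNr. Qed.

Lemma dotv0r z : dotv z 0 = 0.
Proof. by rewrite -(scale0r 0) dotvZr mul0r. Qed.

Lemma dotv_sumr (I : finType) (P : pred I) (v : I -> 'rV[R]_3) z :
  dotv z (\sum_(i | P i) v i) = \sum_(i | P i) dotv z (v i).
Proof.
elim/big_rec2: _ => [|i y1 y2 _ <-]; [exact: dotv0r | exact: dotvDr].
Qed.

Lemma dotv_ge0 x : 0 <= dotv x x.
Proof. by rewrite dotvE sumr_ge0 // => j _; rewrite -expr2 sqr_ge0. Qed.

Lemma dotv_eq0 x : (dotv x x == 0) = (x == 0).
Proof.
apply/eqP/eqP => [|->]; last exact: dotv0r.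
rewrite dotvE => /psumr_eq0P-h; apply/rowP => j; rewrite mxE.
by apply/eqP; rewrite -sqrf_eq0 expr2 h // => k _; rewrite -expr2 sqr_ge0.
Qed.

Lemma dotv_gt0 x : x != 0 -> 0 < dotv x x.
Proof. by rewrite lt0r dotv_ge0 dotv_eq0 andbT. Qed.

Lemma dotv_delta x j : dotv x (delta_mx 0 j) = x 0 j.
Proof.
rewrite dotvE (bigD1 j) //= big1 ?addr0 => [|k kj]; rewrite mxE ?eqxx ?mulr1 //.
by rewrite (negbTE kj) andbF mulr0.
Qed.

Lemma dotv_orth (Q : 'M[R]_3) x y : Q *m Q^T = 1%:M ->
  dotv (x *m Q) (y *m Q) = dotv x y.
Proof. by move=> h; rewrite /dotv trmx_mul mulmxA -(mulmxA x) h mulmx1. Qed.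

End DotProduct.

(** * Affine functionals exposing faces, and affine ranks *)

Section Polytopes.
Context {R : realType} {m : nat}.
Implicit Types (u : 'I_m -> 'rV[R]_3) (E F : {set 'I_m}).
Implicit Types (l : ('rV[R]_3 * R)%type).

(** A pair [l = (a, c)] stands for the affine functional x |-> a . x - c. Pairs form a vector space,
    so functionals combine by [+] and [*:]. *)
Definition aff u l k : R := dotv l.1 (u k) - l.2.

Lemma affD u l l' k : aff u (l + l') k = aff u l k + aff u l' k.
Proof. by rewrite /aff dotvDl /= opprD addrACA. Qed.

Lemma affZ u (t : R) l k : aff u (t *: l) k = t * aff u l k.
Proof. by rewrite /aff /= dotvZl mulrBr. Qed.

Definition exposes u l F : Prop :=
  forall k, aff u l k <= 0 /\ (k \in F <-> aff u l k = 0).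

Lemma is_faceP u F : is_face u F <-> exists l, exposes u l F.
Proof.
split=> [[a [c h]]|[[a c] h]].
  exists (a, c) => k; rewrite /aff /= subr_le0; have [h1 h2] := h k.
  by split=> //; rewrite h2; split=> [->|/eqP]; rewrite ?subrr // subr_eq0 => /eqP.
exists a, c => k; have [] := h k; rewrite /aff /= subr_le0 => -> h2; split=> //.
by rewrite h2; split=> [/eqP|->]; rewrite ?subrr // subr_eq0 => /eqP.
Qed.

Lemma exposes_in u l F k : exposes u l F -> k \in F -> aff u l k = 0.
Proof. by move=> h; have [_ [h1 _]] := h k. Qed.

Lemma exposes_notin u l F k : exposes u l F -> k \notin F -> aff u l k < 0.
Proof.
move=> h kF; have [h1 [_ h2]] := h k; rewrite lt_neqAle h1 andbT.
by apply: contra kF => /eqP /h2.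
Qed.

Definition hmat u F : 'M[R]_(m, 3 + 1) :=
  \matrix_(i < m)
    (if i \in F then row_mx (u i) (const_mx 1 : 'rV[R]_1) else 0).

Definition affcol l : 'cV[R]_(3 + 1) := col_mx l.1^T (- l.2)%:M.

Lemma hmat_aff u F l k :
  row k (hmat u F *m affcol l) = (if k \in F then aff u l k else 0)%:M.
Proof.
rewrite row_mul rowK; case: ifP => _; last by rewrite mul0mx raddf0.
rewrite mul_row_col; apply/matrixP => i j; rewrite !ord1 !mxE /= /aff.
by rewrite dotvC /dotv big_ord1 !mxE eqxx mulr1n mul1r.
Qed.

Lemma hmat_sub u E F : E \subset F -> (hmat u E <= hmat u F)%MS.
Proof.
move=> EF; apply/row_subP => i; rewrite rowK; case: ifP => [iE|_]; last exact: sub0mx.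
have <- : row i (hmat u F) = row_mx (u i) (const_mx 1) by rewrite rowK (fintype.subsetP EF).
exact: row_sub.
Qed.

(** The column of [l] annihilates the homogeneous coordinates of [E] but not those of [F], so the
    inclusion of row spaces is strict. *)
Lemma affine_rank_lt u E F l k : E \subset F ->
  (forall i, i \in E -> aff u l i = 0) -> k \in F -> aff u l k != 0 ->
  (affine_rank u E < affine_rank u F)%N.
Proof.
move=> EF lE kF lk; have hEF := hmat_sub u EF.
rewrite /affine_rank -/(hmat u E) -/(hmat u F) (ltn_leqif (mxrank_leqif_sup hEF)).
apply: contra lk => /submxP[D hF].
have hE0 : hmat u E *m affcol l = 0.
  apply/row_matrixP => i; rewrite hmat_aff row0; case: ifP => [/lE ->|_];
  by rewrite raddf0.
have := hmat_aff u F l k; rewrite kF hF -mulmxA hE0 mulmx0 row0.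
by move=> /matrixP /(_ 0 0); rewrite !mxE eqxx mulr1n => <-.
Qed.

Lemma affine_rank_le u E F : E \subset F ->
  (affine_rank u E <= affine_rank u F)%N.
Proof. by move=> EF; apply: mxrankS (hmat_sub u EF). Qed.

(** A column of the cokernel of the coordinates of [E] that does not annihilate those of [F] is read
    as an affine functional. *)
Lemma affine_rank_ltP u E F : (affine_rank u E < affine_rank u F)%N ->
  exists l, (forall i, i \in E -> aff u l i = 0) /\
    exists2 k, k \in F & aff u l k != 0.
Proof.
move=> h; have : ~~ (hmat u F <= hmat u E)%MS.
  by apply: contraL h => /mxrankS; rewrite -leqNgt.
rewrite submxE => /matrix0Pn[k [j hkj]].
pose z : 'cV[R]_(3 + 1) := cokermx (hmat u E) *m delta_mx j 0.
pose l := ((usubmx z)^T, - dsubmx z 0 0) : 'rV[R]_3 * R.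
have lz : affcol l = z.
  rewrite /affcol /= trmxK opprK -[RHS]vsubmxK; congr col_mx.
  by apply/matrixP => a b; rewrite !ord1 [LHS]mxE eqxx mulr1n.
exists l; split=> [i iE|].
  have := hmat_aff u E l i; rewrite iE lz /z mulmxA mulmx_coker mul0mx row0.
  by move=> /matrixP /(_ 0 0); rewrite !mxE eqxx mulr1n => <-.
have := hmat_aff u F l k; rewrite lz /z mulmxA -colE => /matrixP /(_ 0 0).
rewrite [LHS]mxE [LHS]mxE [RHS]mxE eqxx mulr1n => hk; move: hkj; rewrite hk.
by case: ifP => [kF lk|_]; [exists k | rewrite eqxx].
Qed.

Lemma affine_rank_pair u i j : (affine_rank u [set i; j] <= 2)%N.
Proof.
pose B : 'M[R]_(1 + 1, 3 + 1) :=
  col_mx (row_mx (u i) (const_mx 1)) (row_mx (u j) (const_mx 1)).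
suff /mxrankS/leq_trans : (hmat u [set i; j] <= B)%MS by apply; exact: rank_leq_row.
apply/row_subP => k; rewrite rowK; case: ifP => [|_]; last exact: sub0mx.
rewrite !inE => /orP[]/eqP->.
  by rewrite /B -addsmxE addsmxSl.
by rewrite /B -addsmxE addsmxSr.
Qed.

Lemma affine_rank1_gt0 u i F : i \in F -> (0 < affine_rank u F)%N.
Proof.
move=> iF; apply: leq_ltn_trans (leq0n (affine_rank u finset.set0)) _.
apply: (@affine_rank_lt u finset.set0 F (0, 1) i) => //; first exact: finset.sub0set.
  by move=> k; rewrite inE.
by rewrite /aff /= dotvC dotv0r sub0r oppr_eq0 oner_eq0.
Qed.

Lemma affine_rank1 u i : affine_rank u [set i] = 1%N.
Proof.
apply/eqP; rewrite eqn_leq (@affine_rank1_gt0 u i) ?finset.set11 // andbT.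
suff /mxrankS/leq_trans : (hmat u [set i] <= row_mx (u i) (const_mx 1))%MS.
  by apply; exact: rank_leq_row.
apply/row_subP => k; rewrite rowK; case: ifP => [|_]; last exact: sub0mx.
by rewrite !inE => /eqP->.
Qed.

(** As [f] is negative off [F], adding a large multiple of it to [h] makes the sum negative there
    and leaves [h] unchanged on [F]. *)
Lemma face_of_face u f h E F : exposes u f F -> E \subset F ->
  (forall k, k \in F -> aff u h k <= 0 /\ (k \in E <-> aff u h k = 0)) ->
  is_face u E.
Proof.
(* Each summand of [K] settles its own vertex, and the others are nonnegative. *)
move=> hf EF hh; pose K := \sum_(k | k \notin F) (1 + `|aff u h k|) / - aff u f k.
have pos k : k \notin F -> 0 < - aff u f k.
  by move=> /(exposes_notin hf); rewrite oppr_gt0.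
have hK k : k \notin F -> aff u h k + K * aff u f k < 0.
  move=> kF; have fk := pos k kF.
  suff : 1 + `|aff u h k| <= K * - aff u f k by have := ler_norm (aff u h k); lra.
  rewrite -ler_pdivrMr // /K (bigD1 k) //= lerDl sumr_ge0 // => j /andP[jF _].
  by rewrite divr_ge0 ?(ltW (pos _ jF)) // addr_ge0.
apply/is_faceP; exists (h + K *: f) => k; rewrite affD affZ.
have [kF|kF] := boolP (k \in F).
  by rewrite (exposes_in hf kF) mulr0 addr0; exact: hh.
have hk := hK k kF; split; first exact: ltW.
by split=> [/(fintype.subsetP EF)|hk0]; [rewrite (negbTE kF) | rewrite hk0 ltxx in hk].
Qed.

(** Edges at [i] are found by extremal slope: [n] vanishes on the line through [i] and [k0], [-g]
    measures the depth below [i], and the vertices of [F] maximizing [n / -g] lie with [i] on the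
    edge that [n + t *: g] exposes within [F]. *)
Lemma extremal_edge u F i g n k0 k1 :
  face_of_dim u 2 F -> i \in F -> exposes u g [set i] -> aff u n i = 0 ->
  k0 \in F -> k0 != i -> aff u n k0 = 0 -> k1 \in F -> aff u n k1 != 0 ->
  exists E t, [/\ is_flag u i E F, exists2 j, j \in E & j != i,
    (forall k, k \in F -> aff u n k <= t * - aff u g k) &
    forall k, k \in E -> aff u n k = t * - aff u g k].
Proof.
move=> hF iF hg ni k0F k0i n0 k1F n1.
have [/is_faceP[f hf] rF] := hF.
have k1i : k1 != i by apply: contra n1 => /eqP->; rewrite ni.
have gneg k : k != i -> 0 < - aff u g k.
  by move=> ki; rewrite oppr_gt0 (exposes_notin hg) // inE.
have gi : aff u g i = 0 by apply: (exposes_in hg); rewrite inE.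
pose P k := (k \in F) && (k != i).
have Pk0 : P k0 by rewrite /P k0F.
pose s k := aff u n k / - aff u g k.
case: (Order.TotalTheory.arg_maxP s Pk0) => j /andP[jF ji] jmax.
pose t := s j; pose h := n + t *: g.
have sE k : k != i -> aff u n k = s k * - aff u g k.
  by move=> /gneg; rewrite lt0r => /andP[g0 _]; rewrite /s divfK.
have hE k : k != i -> aff u h k = (s k - t) * - aff u g k.
  by move=> ki; rewrite affD affZ (sE k ki); ring.
have hi : aff u h i = 0 by rewrite affD affZ ni gi mulr0 addr0.
have hle k : k \in F -> aff u h k <= 0.
  have [->|ki kF] := eqVneq k i; first by rewrite hi.
  rewrite hE // mulr_le0_ge0 ?(ltW (gneg k ki)) // subr_le0.
  by apply: jmax; rewrite /P kF.
pose E := [set k in F | aff u h k == 0].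
have EF : E \subset F by apply/fintype.subsetP => k; rewrite inE => /andP[].
have hj : aff u h j = 0 by rewrite hE // /t subrr mul0r.
(* [h] must not vanish on all of [F], so that the rank of [E] is below 3; [k1] witnesses this if
   [t = 0], and [k0] otherwise. *)
have [w wF hw] : exists2 w, w \in F & aff u h w != 0.
  have [st|st] := eqVneq t 0.
    by exists k1 => //; rewrite affD affZ st mul0r addr0.
  exists k0 => //; rewrite affD affZ n0 add0r mulf_neq0 //.
  by have := gneg _ k0i; rewrite lt0r oppr_eq0 => /andP[].
exists E, t; split=> [||k kF|k].
- split=> //; last by rewrite inE iF hi eqxx.
  split; first by apply: (face_of_face (h := h) hf EF) => k kF;
    split; [exact: hle | rewrite inE kF; split=> /eqP].
  apply/eqP; rewrite eqn_leq -ltnS -rF; apply/andP; split.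
    apply: affine_rank_lt EF _ wF hw => k; by rewrite inE => /andP[_ /eqP].
  rewrite -(affine_rank1 u i); apply: (@affine_rank_lt _ _ _ g j).
  + by rewrite finset.sub1set inE iF hi eqxx.
  + by move=> k; rewrite inE => /eqP->.
  + by rewrite inE jF hj eqxx.
  + by rewrite -oppr_eq0; have := gneg _ ji; rewrite lt0r => /andP[].
- by exists j => //; rewrite inE jF hj eqxx.
- by have := hle k kF; rewrite affD affZ; lra.
- by rewrite inE => /andP[_ /eqP]; rewrite affD affZ; lra.
Qed.

(** The edges are those of maximal slope for [n] and for [-n]. If they coincided, the maximal and
    minimal slopes would agree and [n] would be a multiple of [g] on [F]; vanishing at [k0] would
    then make it zero at [k1]. *)
Lemma two_edges u F i : vertices_of_polyhedron u -> face_of_dim u 2 F ->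
  i \in F -> exists E E', [/\ is_flag u i E F, is_flag u i E' F & E != E'].
Proof.
move=> [_ /(_ i)/is_faceP[g hg]] hF iF; have [_ rF] := hF.
have [n' [n'0 [k0 k0F nk0]]] : exists l, (forall k, k \in [set i; i] -> aff u l k = 0) /\
    exists2 k, k \in F & aff u l k != 0.
  by apply: affine_rank_ltP; rewrite rF ltnS affine_rank_pair.
have k0i : k0 != i by apply: contra nk0 => /eqP->; rewrite n'0 ?inE ?eqxx.
have [n [n0 [k1 k1F nk1]]] : exists l, (forall k, k \in [set i; k0] -> aff u l k = 0) /\
    exists2 k, k \in F & aff u l k != 0.
  by apply: affine_rank_ltP; rewrite rF ltnS affine_rank_pair.
have ni : aff u n i = 0 by rewrite n0 ?inE ?eqxx.
have nk : aff u n k0 = 0 by rewrite n0 ?inE ?eqxx ?orbT.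
have Nn k : aff u (-1 *: n) k = - aff u n k by rewrite affZ mulN1r.
have [E [t [hE [j jE ji] tle tE]]] := extremal_edge hF iF hg ni k0F k0i nk k1F nk1.
have [|||E' [t' [hE' _ tle' tE']]] :=
  @extremal_edge u F i g (-1 *: n) k0 k1 hF iF hg _ k0F k0i _ k1F _.
- by rewrite Nn ni oppr0.
- by rewrite Nn nk oppr0.
- by rewrite Nn oppr_eq0.
exists E, E'; split=> //; apply/eqP => EE'.
have gj : aff u g j < 0 by rewrite (exposes_notin hg) // inE.
have := tE j jE; have := tE' j; rewrite -EE' => /(_ jE); rewrite Nn => h1 h2.
have tt : t' = - t.
  have : (t' + t) * aff u g j = 0 by rewrite mulrDl; lra.
  by move/eqP; rewrite mulf_eq0 (lt_eqF gj) orbF addr_eq0 => /eqP.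
have slope k : k \in F -> aff u n k = t * - aff u g k.
  move=> kF; apply/eqP; rewrite eq_le tle //=.
  by have := tle' k kF; rewrite Nn tt; lra.
have gk0 : aff u g k0 < 0 by rewrite (exposes_notin hg) // inE.
have := slope k0 k0F; rewrite nk => /esym/eqP.
rewrite mulf_eq0 oppr_eq0 (lt_eqF gk0) orbF => /eqP t0.
by move: nk1; rewrite slope // t0 mul0r eqxx.
Qed.

(** The supporting plane of [F] is tilted about [E] until it meets a new vertex: [t] is the least
    ratio of [e] to [f] off [F]. The functional [e - t f] equals [e] on [F], so it is negative at a
    vertex of [F] outside [E]. *)
Lemma other_facet u E F : vertices_of_polyhedron u -> face_of_dim u 1 E ->
  face_of_dim u 2 F -> E \subset F ->
  exists F', [/\ face_of_dim u 2 F', E \subset F' & F' != F].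
Proof.
move=> [rT _] [/is_faceP[e he] rE] [/is_faceP[f hf] rF] EF.
have [k0 k0F] : exists k, k \notin F.
  apply/existsP; rewrite -negb_forall; apply/negP => /forallP hall.
  have FT : F = [set: 'I_m] by apply/setP => k; rewrite inE hall.
  by move: rF; rewrite FT rT.
have [w wF wE] : exists2 w, w \in F & w \notin E.
  suff /fintype.subsetPn : ~~ (F \subset E) by [].
  by apply/negP => /(affine_rank_le u); rewrite rE rF.
pose P k := k \notin F; pose s k := aff u e k / aff u f k.
case: (@Order.TotalTheory.arg_minP _ _ _ k0 P s k0F) => j jF jmin.
pose t := s j; pose h := e + (- t) *: f.
pose F' := [set k | aff u h k == 0].
have fneg k : k \notin F -> aff u f k < 0 by apply: exposes_notin.
have hE k : k \notin F -> aff u h k = (s k - t) * aff u f k.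
  move=> kF; rewrite affD affZ mulrBl /s divfK ?mulNr //.
  by rewrite lt_eqF // fneg.
have hF k : k \in F -> aff u h k = aff u e k.
  by move=> kF; rewrite affD affZ (exposes_in hf kF) mulr0 addr0.
have hhF : exposes u h F'.
  move=> k; split; last by rewrite inE; split=> /eqP.
  have [kF|kF] := boolP (k \in F); first by rewrite hF //; have [] := he k.
  by rewrite hE // mulr_ge0_le0 ?(ltW (fneg k kF)) // subr_ge0; apply: jmin.
have EF' : E \subset F'.
  apply/fintype.subsetP => k kE; rewrite inE hF ?(fintype.subsetP EF) //.
  by rewrite (exposes_in he kE).
have jF' : j \in F' by rewrite inE hE // /t subrr mul0r.
exists F'; split=> //; last by apply: contra jF => /eqP<-.
split; first by apply/is_faceP; exists h.
apply/eqP; rewrite eqn_leq -ltnS -[4%N]rT -[3%N]/(2.+1) -rE; apply/andP; split.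
  apply: (@affine_rank_lt _ _ _ h w); rewrite ?inE ?finset.subsetT //.
    by move=> k /(exposes_in hhF).
  by rewrite hF // lt_eqF // (exposes_notin he).
apply: (@affine_rank_lt _ _ _ f j) => //; last by rewrite lt_eqF // fneg.
by move=> k /(fintype.subsetP EF) /(exposes_in hf).
Qed.

Lemma edge_other u i E : face_of_dim u 1 E -> exists2 j, j \in E & j != i.
Proof.
move=> [_ rE]; suff /fintype.subsetPn[j jE] : ~~ (E \subset [set i]).
  by rewrite inE => ji; exists j.
by apply/negP => /(affine_rank_le u); rewrite rE affine_rank1.
Qed.

(** Two distinct vertices already have affine rank 2, that of the whole edge. *)
Lemma edge_eq0 u E l i j : vertices_of_polyhedron u -> face_of_dim u 1 E ->
  i \in E -> j \in E -> j != i -> aff u l i = 0 -> aff u l j = 0 ->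
  forall k, k \in E -> aff u l k = 0.
Proof.
move=> [_ /(_ i)/is_faceP[g hg]] [_ rE] iE jE ji li lj k kE.
apply/eqP/negPn/negP => lk.
have sE : [set i; j] \subset E.
  by apply/fintype.subsetP => x; rewrite !inE => /orP[]/eqP->.
have := affine_rank_lt sE _ kE lk; rewrite rE ltnS leqNgt => h.
apply: (negP (h _)).
  by move=> x; rewrite !inE => /orP[]/eqP->.
rewrite -(affine_rank1 u i); apply: (@affine_rank_lt _ _ _ g j).
- by apply/fintype.subsetP => x; rewrite !inE => ->.
- by move=> x /(exposes_in hg).
- by rewrite !inE eqxx orbT.
- by rewrite lt_eqF // (exposes_notin hg) // inE.
Qed.

(** On the edge, a functional vanishing at [i] is a multiple of the one exposing [i], and the latter
    has a negative sum over the edge. *)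
Lemma edge_sum_eq0 u E l i : vertices_of_polyhedron u -> face_of_dim u 1 E ->
  i \in E -> aff u l i = 0 -> \sum_(k in E) aff u l k = 0 ->
  forall k, k \in E -> aff u l k = 0.
Proof.
move=> hu hE iE li lE; have [j jE ji] := edge_other i hE.
have [_ /(_ i)/is_faceP[g hg]] := hu.
have gi : aff u g i = 0 by apply: (exposes_in hg); rewrite inE.
have gj : aff u g j < 0 by rewrite (exposes_notin hg) // inE.
pose t := aff u l j / aff u g j.
have lg k : k \in E -> aff u l k = t * aff u g k.
  move=> kE; have := @edge_eq0 u E (l + (- t) *: g) i j hu hE iE jE ji.
  rewrite !affD !affZ li gi mulr0 addr0 mulNr /t divfK ?lt_eqF // subrr.
  by move=> /(_ erefl erefl k kE); rewrite affD affZ; lra.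
suff t0 : t = 0 by move=> k /lg; rewrite t0 mul0r.
move: lE; rewrite (eq_bigr _ lg) -mulr_sumr => /eqP; rewrite mulf_eq0.
case/orP=> [/eqP//|/eqP s0]; suff : \sum_(k in E) aff u g k < 0 by rewrite s0 ltxx.
rewrite (bigD1 j) //= ltr_wnDr // sumr_le0 // => k _; by have [] := hg k.
Qed.

(** An edge and one further vertex of the facet already reach affine rank 3, that of the facet. *)
Lemma facet_eq0 u E F l k : face_of_dim u 1 E -> face_of_dim u 2 F ->
  E \subset F -> k \in F -> k \notin E ->
  (forall x, x \in E -> aff u l x = 0) -> aff u l k = 0 ->
  forall x, x \in F -> aff u l x = 0.
Proof.
move=> [/is_faceP[e he] rE] [_ rF] EF kF kE lE lk x xF.
apply/eqP/negPn/negP => lx.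
have sF : k |: E \subset F.
  by apply/fintype.subsetP => y; rewrite !inE => /orP[/eqP->|/(fintype.subsetP EF)].
have := affine_rank_lt sF _ xF lx; rewrite rF ltnS leqNgt => h.
apply: (negP (h _)).
  by move=> y; rewrite !inE => /orP[/eqP->|/lE].
rewrite -rE; apply: (@affine_rank_lt _ _ _ e k).
- exact: finset.subsetUr.
- by move=> y /(exposes_in he).
- by rewrite !inE eqxx.
- by rewrite lt_eqF // (exposes_notin he).
Qed.

End Polytopes.

(** * Reflections *)


Section Reflections.
Context {R : realType}.
Implicit Types (n x y : 'rV[R]_3) (Q W : 'M[R]_3).

Definition reflection n Q : Prop :=
  dotv n n = 2 /\ forall x, x *m Q = x - dotv x n *: n.

(** The matrix is 1 - n^T n; its determinant is expanded and simplified with n . n = 2. *)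
Lemma det_reflection n Q : reflection n Q -> \det Q = -1.
Proof.
move=> [nn hQ].
have Qij i j : Q i j = (i == j)%:R - n 0 i * n 0 j.
  have := congr1 (fun v : 'rV[R]_3 => v 0 j) (hQ (delta_mx 0 i)).
  rewrite -rowE !mxE eqxx /= => ->; rewrite dotvE (bigD1 i) //= big1 ?addr0.
    by rewrite mxE !eqxx mul1r eq_sym.
  by move=> k ki; rewrite mxE (negbTE ki) andbF mul0r.
pose v k : R := n 0 (inord k); have nv i : n 0 i = v i by rewrite /v inord_val.
move: nn; rewrite dotvE !big_ord_recl big_ord0 !nv /= /bump /= !addn0 !addn1 => nn.
rewrite (expand_det_row _ 0) !big_ord_recl big_ord0 /cofactor.
rewrite !(expand_det_row _ 0) !big_ord_recl !big_ord0 /cofactor !det_mx11 !mxE.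
rewrite !Qij !nv /= /bump /= !addn0 !add0n !addn1 expr0 expr1 expr2.
have aa : v 0%N * v 0%N = 2 - v 1%N * v 1%N - v 2%N * v 2%N by rewrite -nn; ring.
by ring: aa.
Qed.

Lemma unitmx_indep W : (forall c : 'rV[R]_3, \sum_k c 0 k *: row k W = 0 -> c = 0) ->
  W \in unitmx.
Proof.
move=> h; rewrite -row_free_unit; apply: inj_row_free => c cW; apply: h.
by rewrite -mulmx_sum_row.
Qed.

(* Reflecting the k-th vector of a basis, the other two being fixed, moves it
   by d with 2 w_k . d + d . d = 0; the root is d rescaled. *)
Lemma reflectionP W k Q : W \in unitmx -> Q *m Q^T = 1%:M ->
  (forall l, l != k -> row l W *m Q = row l W) -> row k W *m Q != row k W ->
  exists n, [/\ reflection n Q, dotv (row k W) n != 0 &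
    forall l, l != k -> dotv (row l W) n = 0].
Proof.
move=> uW oQ fixQ movQ; have [d dE] : exists d, d = row k W *m Q - row k W by eexists.
have d0 : d != 0 by rewrite dE subr_eq0.
have D0 := dotv_gt0 d0; pose r := Num.sqrt (2 / dotv d d).
have rr : r * r = 2 / dotv d d.
  by rewrite -expr2 sqr_sqrtr // divr_ge0 // ltW.
have wd : 2 * dotv (row k W) d = - dotv d d.
  have : dotv (row k W + d) (row k W + d) = dotv (row k W) (row k W).
    by rewrite dE addrC subrK dotv_orth.
  by rewrite !dotvDl !dotvDr [dotv d (row k W)]dotvC; lra.
have wl l : l != k -> dotv (row l W) d = 0.
  by move=> lk; rewrite dE dotvBr -{1}(fixQ l lk) dotv_orth // subrr.
have r0 : r != 0.
  by rewrite lt0r_neq0 // sqrtr_gt0 divr_gt0.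
exists (r *: d); split.
- split; first by rewrite dotvZl dotvZr mulrA rr divfK // lt0r_neq0.
  move=> x; have -> : x = (x *m invmx W) *m W by rewrite mulmxKV.
  set c := x *m invmx W; rewrite (mulmx_sum_row c W) mulmx_suml.
  have -> : \sum_i (c 0 i *: row i W) *m Q = \sum_i c 0 i *: row i W + c 0 k *: d.
    rewrite (bigD1 k) //= [in RHS](bigD1 k) //= -scalemxAl.
    rewrite (eq_bigr (fun i => c 0 i *: row i W)) => [|i ik].
      by rewrite dE scalerBr; apply/rowP => j; rewrite !mxE; ring.
    by rewrite -scalemxAl fixQ.
  congr (_ + _); rewrite dotvC dotv_sumr (bigD1 k) //= big1 ?addr0.
    rewrite dotvZl dotvZr [dotv d _]dotvC scalerA -scaleNr; congr (_ *: _).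
    have -> : r * (c 0 k * dotv (row k W) d) * r
             = (r * r) * (c 0 k * dotv (row k W) d) by ring.
    have -> : dotv (row k W) d = - dotv d d / 2 by rewrite -wd; field.
    by rewrite rr; field; rewrite lt0r_neq0.
  by move=> i ik; rewrite dotvZr dotvZl dotvC wl // !mulr0.
- rewrite dotvZr mulf_neq0 //; apply/eqP => wd0; move: wd.
  by rewrite wd0 mulr0 => /esym/eqP; rewrite oppr_eq0 gt_eqF.
- by move=> l lk; rewrite dotvZr wl // mulr0.
Qed.

(** If the k-th basis vector moved, [Q] would be a reflection, of determinant -1. *)
Lemma orth_fix_eq1 W k Q : W \in unitmx -> Q *m Q^T = 1%:M -> \det Q = 1 ->
  (forall l, l != k -> row l W *m Q = row l W) -> Q = 1%:M.
Proof.
move=> uW oQ dQ fixQ; have [fk|mk] := eqVneq (row k W *m Q) (row k W).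
  have : W *m Q = W.
    apply/row_matrixP => l; rewrite row_mul.
    by have [->|/fixQ] := eqVneq l k.
  by move/(congr1 (mulmx (invmx W))); rewrite mulKmx // mulVmx.
have [n [/det_reflection]] := reflectionP uW oQ fixQ mk.
by rewrite dQ => /eqP; rewrite -addr_eq0 -[1 + 1]/(2%:R) pnatr_eq0.
Qed.

(* Possible values of 4 cos^2 for the angle between the mirrors of two
   reflections whose product has order p; for p = 5 both roots occur. *)
Definition coxeter_rel (p : nat) (a : R) : Prop :=
  match p with
  | 3 => a = 1
  | 4 => a = 2
  | 5 => a ^+ 2 - 3 * a + 1 = 0
  | _ => True
  end.

(** On the plane of the two roots the product f is a rotation with f^2 = tau f - 1. Hence f^p n0 = c
    f n0 - d n0 with c and d polynomials in tau, and f^p n0 = n0 forces c = 0 and d = -1. *)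
Lemma reflection_prod_order n0 n1 Q0 Q1 w0 w1 p :
  reflection n0 Q0 -> reflection n1 Q1 ->
  dotv w0 n0 != 0 -> dotv w0 n1 = 0 -> dotv w1 n1 != 0 -> dotv n0 n1 != 0 ->
  iter p (fun x : 'rV[R]_3 => x *m Q0 *m Q1) n0 = n0 ->
  coxeter_rel p (dotv n0 n1 ^+ 2).
Proof.
move=> [n00 h0] [n11 h1] w00 w01 w11; set t := dotv n0 n1 => t0.
(* [tau] is the trace of this rotation, twice the cosine of its angle. *)
pose f (x : 'rV[R]_3) : 'rV[R]_3 := x *m Q0 *m Q1; pose tau := t ^+ 2 - 2.
have f0 : f n0 = - n0 + t *: n1.
  rewrite /f h0 h1 n00 !dotvBl dotvZl -/t !scalerBl !scalerDl.
  by apply/rowP => i; rewrite !mxE; ring.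
have f1 : f (f n0) = tau *: f n0 - n0.
  have fD x y c : f (- x + c *: y) = - f x + c *: f y.
    by rewrite /f !mulmxDl !mulNmx -!scalemxAl.
  have fn1 : f n1 = - t *: n0 + (t ^+ 2 - 1) *: n1.
    rewrite /f h0 h1 [dotv n1 n0]dotvC -/t !dotvBl dotvZl -/t n11.
    by apply/rowP => i; rewrite !mxE; ring.
  rewrite f0 fD fn1 f0 /tau.
  by apply/rowP => i; rewrite !mxE; ring.
have fZ c d : f (c *: f n0 - d *: n0) = (c * tau - d) *: f n0 - c *: n0.
  have -> : f (c *: f n0 - d *: n0) = c *: f (f n0) - d *: f n0.
    by rewrite /f !mulmxBl -!scalemxAl.
  by rewrite f1; apply/rowP => i; rewrite !mxE; ring.
(* Pairing with [w0], which is orthogonal to [n1], isolates the coefficient of [n0]; pairing with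
   [w1] then settles that of [n1]. *)
have key c d : c *: f n0 - d *: n0 = n0 -> c = 0 /\ d = -1.
  rewrite f0 => hcd.
  have := congr1 (dotv w0) hcd; have := congr1 (dotv w1) hcd.
  rewrite !dotvBr !dotvZr !dotvDr !dotvNr !dotvZr w01 => e1 e0.
  have cd : c + d + 1 = 0.
    apply: (mulIf w00); rewrite mul0r; move: e0; lra.
  have ct : c * t = 0.
    apply: (mulIf w11); rewrite mul0r.
    have dE : d = - 1 - c by lra.
    have : c * (- dotv w1 n0 + t * dotv w1 n1) - d * dotv w1 n0 - dotv w1 n0 = 0.
      by rewrite e1 subrr.
    by rewrite dE => <-; ring.
  have c0 : c = 0 by move/eqP: ct; rewrite mulf_eq0 (negbTE t0) orbF => /eqP.
  by split=> //; lra.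
have it2 : f (f n0) = tau *: f n0 - 1 *: n0 by rewrite f1 scale1r.
have tE : t ^+ 2 = tau + 2 by rewrite /tau; ring.
(* The relations are tau = -1 for p = 3, tau = 0 for p = 4 and tau^2 + tau - 1 = 0 for p = 5. For 4
   and 5, d = -1 is multiplied by tau to eliminate the top power against c = 0. *)
rewrite -/t tE; case: p => [|[|[|[|[|[|p]]]]]] //=; rewrite -!/(f _) it2 !fZ => /key[].
- by move=> _ h; lra.
- by move=> h1' h2'; have := congr1 (fun z => tau * z) h2'; rewrite /=; lra.
- move=> c0 d1; have : (tau ^+ 2 + tau - 1) = 0.
    have := congr1 (fun z => tau * z) d1; rewrite /=; lra.
  by lra.
Qed.

End Reflections.

(** * Symmetries and flags *)


(** A nontrivial power of [s] fixes no point of [S], so all orbits in [S] have length the order of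
    [s], which therefore divides [#|S|]. *)
Lemma semiregular_card_dvd (aT : finGroupType) (T : finType)
    (to : {action aT &-> T}) (s : aT) (S : {set T}) :
  (forall x, x \in S -> to x s \in S) ->
  (forall k x, x \in S -> to x (s ^+ k)%g = x -> (s ^+ k = 1)%g) ->
  (s ^+ #|S| = 1)%g.
Proof.
move=> stab free.
have actS : [acts <[s]>%g, on S | to].
  rewrite gen_subG; apply/fintype.subsetP => _ /set1P ->; rewrite inE.
  by apply/andP; split; rewrite ?inE //; apply/fintype.subsetP => x /stab; rewrite inE.
have sumS := acts_sum_card_orbit actS.
suff -> : #|S| = (#|orbit to <[s]>%g @: S| * #[s]%g)%N.
  by rewrite mulnC expgM expg_order expg1n.
rewrite -sumS -sum_nat_const; apply: eq_bigr => _ /imsetP[x xS ->].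
rewrite card_orbit; suff -> : 'C_(<[s]>)[x | to]%g = 1%g by rewrite indexg1.
apply/trivgP/fintype.subsetP => g /setIP[/cycleP[k ->]].
by move=> /astab1P/(free k x xS)->; rewrite inE.
Qed.

Section Flags.
Context {R : realType} {m : nat}.
Implicit Types (u : 'I_m -> 'rV[R]_3) (E F : {set 'I_m}) (Q : 'M[R]_3).
Implicit Types (s : {perm 'I_m}).

Definition linear_symmetry u s Q : Prop :=
  Q *m Q^T = 1%:M /\ forall i, u (s i) = u i *m Q.

(** An isometry permuting the vertices fixes their centroid, the origin, so its translation part
    vanishes. *)
Lemma is_symmetry_linear u s : (0 < m)%N -> centered u -> is_symmetry u s ->
  exists Q, linear_symmetry u s Q.
Proof.
move=> m0 cu [Q [t [oQ h]]]; exists Q; split=> // i; rewrite h.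
suff -> : t = 0 by rewrite addr0.
have : \sum_i u (s i) = 0 by rewrite -[RHS]cu [RHS](reindex_inj (@perm_inj _ s)).
under eq_bigr do rewrite h.
rewrite big_split /= -mulmx_suml [X in X *m Q]cu mul0mx add0r sumr_const card_ord.
by move/eqP; rewrite -scaler_nat scaler_eq0 pnatr_eq0 -leqn0 leqNgt m0 => /eqP.
Qed.

Lemma linear_symmetryM u s s' Q Q' : linear_symmetry u s Q ->
  linear_symmetry u s' Q' -> linear_symmetry u (s * s')%g (Q *m Q').
Proof.
move=> [oQ h] [oQ' h']; split; last by move=> i; rewrite permM h' h mulmxA.
by rewrite trmx_mul mulmxA -(mulmxA Q) oQ' mulmx1.
Qed.

Lemma linear_symmetryX u s Q k : linear_symmetry u s Q ->
  linear_symmetry u (s ^+ k)%g (iter k (mulmx^~ Q) 1%:M).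
Proof.
move=> h; elim: k => [|k IH] /=.
  by split=> [|i]; rewrite ?perm1 ?trmx1 ?mulmx1.
by rewrite expgSr; apply: linear_symmetryM.
Qed.

Lemma mulmx_iter (x : 'rV[R]_3) Q k :
  x *m iter k (mulmx^~ Q) 1%:M = iter k (mulmx^~ Q) x.
Proof. by elim: k => [|k IH] /=; rewrite ?mulmx1 // mulmxA IH. Qed.

Lemma det_iter Q k : \det Q = 1 -> \det (iter k (mulmx^~ Q) 1%:M) = 1.
Proof.
by move=> dQ; elim: k => [|k IH] /=; rewrite ?det1 // det_mulmx IH dQ mulr1.
Qed.

Lemma affine_rank_image u s Q F : linear_symmetry u s Q ->
  (affine_rank u (s @: F) <= affine_rank u F)%N.
Proof.
move=> [_ h]; pose D : 'M[R]_(3 + 1) := block_mx Q 0 0 1%:M.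
rewrite /affine_rank -!/(hmat _ _); apply: leq_trans (mxrankM_maxl (hmat u F) D).
apply: mxrankS; apply/row_subP => i; rewrite rowK; case: ifP => [|_]; last exact: sub0mx.
move=> /imsetP[j jF ->]; have <- : row j (hmat u F *m D) = row_mx (u (s j)) (const_mx 1).
  rewrite row_mul rowK jF /D mul_row_block h !mulmx0 addr0 add0r mulmx1.
  by [].
exact: row_sub.
Qed.

Lemma linear_symmetryV u s Q : linear_symmetry u s Q ->
  linear_symmetry u s^-1%g Q^T.
Proof.
move=> [oQ h]; split=> [|i]; first by rewrite trmxK; apply: mulmx1C.
by rewrite -[in RHS](permKV s i) h -mulmxA oQ mulmx1.
Qed.

Lemma face_image u s Q d F : linear_symmetry u s Q ->
  face_of_dim u d F -> face_of_dim u d (s @: F).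
Proof.
move=> hs; have [oQ h] := hs; move=> [[a [c hF]] rF]; split.
  exists (a *m Q), c => i; rewrite -[i](permKV s) h dotv_orth //.
  by rewrite mem_imset; [exact: hF | exact: perm_inj].
rewrite -rF; apply/eqP; rewrite eqn_leq (affine_rank_image _ hs) /=.
have := affine_rank_image (s @: F) (linear_symmetryV hs).
rewrite -imset_comp (eq_imset (g := id)) ?imset_id // => i /=.
by rewrite permK.
Qed.

Definition face_sum u F : 'rV[R]_3 := \sum_(k in F) u k.

Lemma face_sum_image u s Q F : linear_symmetry u s Q ->
  face_sum u F *m Q = face_sum u (s @: F).
Proof.
move=> [_ h]; rewrite /face_sum mulmx_suml big_imset /=; last first.
  by move=> x y _ _; apply: perm_inj.
by apply: eq_bigr => k _; rewrite h.
Qed.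

Lemma aff_face_sum u l F :
  \sum_(k in F) aff u l k = dotv l.1 (face_sum u F) - l.2 * #|F|%:R.
Proof.
by rewrite big_split /= -dotv_sumr sumr_const mulr_natr mulNrn.
Qed.

Lemma exposed_sum_lt0 u l F F' k : exposes u l F -> k \in F' -> k \notin F ->
  \sum_(x in F') aff u l x < 0.
Proof.
move=> hl kF' kF; rewrite (bigD1 k) //= ltr_wnDr ?(exposes_notin hl) //.
by rewrite sumr_le0 // => x _; have [] := hl x.
Qed.

Lemma exposed_sum_eq0 u l F : exposes u l F -> \sum_(x in F) aff u l x = 0.
Proof. by move=> hl; rewrite big1 // => x /(exposes_in hl). Qed.

(** A functional exposing [F] sums to 0 over [F], and to a negative number over an image having a
    vertex outside [F]; equal vertex sums and cardinalities exclude the latter. *)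
Lemma face_sum_inj u s F : is_face u F -> face_sum u (s @: F) = face_sum u F ->
  s @: F = F.
Proof.
move=> /is_faceP[l hl] hsum.
have cF : #|s @: F| = #|F| by rewrite card_imset //; apply: perm_inj.
apply/eqP; rewrite eqEcard cF leqnn andbT; apply/negPn/negP => /fintype.subsetPn[k k1 k2].
have := exposed_sum_lt0 hl k1 k2.
by rewrite aff_face_sum cF hsum -aff_face_sum (exposed_sum_eq0 hl) ltxx.
Qed.

Definition flag_basis u i E F : 'M[R]_3 :=
  \matrix_(k < 3) nth 0 [:: u i; face_sum u E; face_sum u F] k.

(* A linear relation between the three vectors is killed by applying to it
   functionals exposing the facet, the edge and the vertex. *)
Lemma flag_basis_unit u i E F : (0 < m)%N -> vertices_of_polyhedron u ->
  centered u -> is_flag u i E F -> flag_basis u i E F \in unitmx.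
Proof.
move=> m0 [rT hv] cu [[hE rE] [hF rF] iE EF].
apply: unitmx_indep => c; rewrite !big_ord_recl big_ord0 addr0 !rowK /=.
set c0 := c 0 _; set c1 := c 0 _; set c2 := c 0 _ => hc.
have /is_faceP[f hf] := hF; have /is_faceP[e he] := hE; have /is_faceP[g hg] := hv i.
have [k kF] : exists k, k \notin F.
  apply/existsP; rewrite -negb_forall; apply/negP => /forallP hall.
  have FT : F = [set: 'I_m] by apply/setP => x; rewrite inE hall.
  by move: rF; rewrite FT rT.
(* The vertices sum to 0 while [f] has a negative sum over them, so the plane of the facet misses
   the origin. *)
have f2 : 0 < f.2.
  have := exposed_sum_lt0 hf (finset.in_setT k) kF; rewrite aff_face_sum.
  have -> : face_sum u [set: 'I_m] = 0.
    by rewrite -[RHS]cu; apply: eq_bigl => x; rewrite inE.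
  rewrite dotv0r sub0r oppr_lt0 pmulr_lgt0 //.
  by rewrite ltr0n; apply/card_gt0P; exists k; rewrite inE.
have F0 : f.2 != 0 by rewrite lt0r_neq0.
(* The relation between the vectors is rewritten in values of [l]; the last term collects the
   constant parts. *)
have comb (l : 'rV[R]_3 * R) : c0 * aff u l i + c1 * (\sum_(x in E) aff u l x) +
    c2 * (\sum_(x in F) aff u l x) + l.2 * (c0 + c1 * #|E|%:R + c2 * #|F|%:R) = 0.
  have := congr1 (dotv l.1) hc.
  rewrite dotv0r !dotvDr !dotvZr !aff_face_sum /aff.
  by move=> <-; ring.
have s0 : c0 + c1 * #|E|%:R + c2 * #|F|%:R = 0.
  have := comb f; rewrite (exposed_sum_eq0 hf) (exposes_in hf) ?(fintype.subsetP EF) //.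
  rewrite big1 => [|x xE]; last by rewrite (exposes_in hf) // (fintype.subsetP EF).
  by rewrite !mulr0 !add0r => /eqP; rewrite mulf_eq0 (negbTE F0) => /eqP.
have z2 : c2 = 0.
  have [w wF wE] : exists2 w, w \in F & w \notin E.
    apply/fintype.subsetPn/negP => /(affine_rank_le u).
    by rewrite rE rF.
  have := comb e; rewrite s0 mulr0 addr0 (exposed_sum_eq0 he) (exposes_in he) // !mulr0 !add0r.
  by move/eqP; rewrite mulf_eq0 (lt_eqF (exposed_sum_lt0 he wF wE)) orbF => /eqP.
have z1 : c1 = 0.
  have [j jE ji] := edge_other i (conj hE rE).
  have := comb g; rewrite s0 z2 mulr0 mul0r !addr0 (exposes_in hg) ?inE // mulr0 add0r.
  have ji' : j \notin [set i] by rewrite inE.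
  by move/eqP; rewrite mulf_eq0 (lt_eqF (exposed_sum_lt0 hg jE ji')) orbF => /eqP.
have z0 : c0 = 0 by move: s0; rewrite z1 z2 !mul0r !addr0.
apply/rowP => x; rewrite mxE; case: x => [[|[|[|x]]] hx] //.
- by rewrite -z0; congr (c 0 _); apply: val_inj.
- by rewrite -z1; congr (c 0 _); apply: val_inj.
- by rewrite -z2; congr (c 0 _); apply: val_inj.
Qed.

Lemma vertex_inj u x y : vertices_of_polyhedron u -> u x = u y -> x = y.
Proof.
move=> [_ /(_ y)/is_faceP[g hg]] xy; apply/eqP.
have [_ [_]] := hg x; rewrite inE; apply.
by rewrite /aff xy; apply: (exposes_in hg); rewrite inE.
Qed.

(** The first and third vectors of the flag basis are fixed, and the determinant excludes a
    reflection moving the second. *)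
Lemma rotation_fix_eq1 u s Q i E F : (0 < m)%N -> vertices_of_polyhedron u ->
  centered u -> is_flag u i E F -> linear_symmetry u s Q -> \det Q = 1 ->
  s i = i -> s @: F = F -> (s = 1)%g.
Proof.
move=> m0 hu cu hfl hs dQ si sF; have [oQ h] := hs.
have Q1 : Q = 1%:M.
  apply: (orth_fix_eq1 (k := 1) (flag_basis_unit m0 hu cu hfl) oQ dQ) => l.
  case: l => [[|[|[|l]]] hl] // _; rewrite rowK /=.
    by rewrite -h si.
  by rewrite (face_sum_image F hs) sF.
apply/permP => k; rewrite perm1; apply: (vertex_inj hu).
by rewrite h Q1 mulmx1.
Qed.

(** The three symmetries carry a base flag to neighbours differing from it in the vertex, the edge
    and the facet respectively. Up to scaling the roots are the basis dual to [flag_basis], whence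
    the final independence clause. *)
Lemma platonic_reflections u p q : (0 < m)%N -> (0 < q)%N -> platonic_solid u p q ->
  exists s0 s1 s2 Q0 Q1 Q2 n0 n1 n2,
    [/\ linear_symmetry u s0 Q0, linear_symmetry u s1 Q1 &
        linear_symmetry u s2 Q2] /\
    [/\ reflection n0 Q0, reflection n1 Q1 & reflection n2 Q2] /\
    [/\ dotv n0 n2 = 0, coxeter_rel p (dotv n0 n1 ^+ 2),
        coxeter_rel q (dotv n1 n2 ^+ 2), dotv n0 n1 != 0 /\ dotv n1 n2 != 0 &
        forall x, dotv x n0 = 0 -> dotv x n1 = 0 -> dotv x n2 = 0 -> x = 0].
Proof.
move=> m0 q0 [[hu trans] [faces_p faces_q] cu]; pose i := Ordinal m0.
have [F] : exists F, F \in [set F : {set 'I_m} | `[< face_of_dim u 2 F >] & i \in F].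
  by apply/card_gt0P; rewrite faces_q.
rewrite inE => /andP[/asboolP hF iF].
have [E [E' [fl fl' EE']]] := two_edges hu hF iF.
have [hE _ _ EF] := fl; have [hE' _ iE' EF'] := fl'; have [_ _ iE _] := fl.
have [F' [hF' EF2 FF']] := other_facet hu hE hF EF.
have [j jE ji] := edge_other i hE.
have fl0 : is_flag u j E F by split.
have fl2 : is_flag u i E F' by split.
have [s0 [/(is_symmetry_linear m0 cu)[Q0 hs0] s0i s0E s0F]] := trans _ _ _ _ _ _ fl fl0.
have [s1 [/(is_symmetry_linear m0 cu)[Q1 hs1] s1i s1E s1F]] := trans _ _ _ _ _ _ fl fl'.
have [s2 [/(is_symmetry_linear m0 cu)[Q2 hs2] s2i s2E s2F]] := trans _ _ _ _ _ _ fl fl2.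
pose W := flag_basis u i E F; have uW : W \in unitmx := flag_basis_unit m0 hu cu fl.
have W0 : row 0 W = u i by rewrite rowK.
have W1 : row 1 W = face_sum u E by rewrite rowK.
have W2 : row 2%:R W = face_sum u F by rewrite rowK.
have ord3 (P : 'I_3 -> Prop) : P 0 -> P 1 -> P 2%:R -> forall l, P l.
  move=> P0 P1 P2 [[|[|[|l]]] hl] //.
  - by have -> : Ordinal hl = 0 by apply: val_inj.
  - by have -> : Ordinal hl = 1 by apply: val_inj.
  - by have -> : Ordinal hl = 2%:R by apply: val_inj.
have [n0 [r0 w00 w0]] : exists n, [/\ reflection n Q0, dotv (row 0 W) n != 0 &
    forall l, l != 0 -> dotv (row l W) n = 0].
  have [oQ h] := hs0; apply: reflectionP => //.
    by apply: ord3 => // _; rewrite ?W1 ?W2 (face_sum_image _ hs0) ?s0E ?s0F.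
  by rewrite W0 -h s0i; apply: contra ji => /eqP/(vertex_inj hu)->.
have [n1 [r1 w11 w1]] : exists n, [/\ reflection n Q1, dotv (row 1 W) n != 0 &
    forall l, l != 1 -> dotv (row l W) n = 0].
  have [oQ h] := hs1; apply: reflectionP => //.
    by apply: ord3 => // _; rewrite ?W0 ?W2 ?(face_sum_image _ hs1) ?s1F -?h ?s1i.
  rewrite W1 (face_sum_image _ hs1); apply: contra EE' => /eqP/face_sum_inj <-.
    by rewrite s1E.
  by case: hE.
have [n2 [r2 w22 w2]] : exists n, [/\ reflection n Q2, dotv (row 2%:R W) n != 0 &
    forall l, l != 2%:R -> dotv (row l W) n = 0].
  have [oQ h] := hs2; apply: reflectionP => //.
    by apply: ord3 => // _; rewrite ?W0 ?W1 ?(face_sum_image _ hs2) ?s2E -?h ?s2i.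
  rewrite W2 (face_sum_image _ hs2); apply: contra FF' => /eqP/face_sum_inj h'.
  by rewrite -s2F h' //; case: hF.
have w20 : dotv (u i) n2 = 0 by rewrite -W0 w2.
have w21 : dotv (face_sum u E) n2 = 0 by rewrite -W1 w2.
have w10 : dotv (u i) n1 = 0 by rewrite -W0 w1.
have w01 : dotv (face_sum u E) n0 = 0 by rewrite -W1 w0.
have aff0 v k : aff u (v, 0) k = dotv (u k) v by rewrite /aff /= subr0 dotvC.
have sum0 v (A : {set 'I_m}) : \sum_(k in A) aff u (v, 0) k = dotv (face_sum u A) v.
  by rewrite aff_face_sum mul0r subr0 dotvC.
have n2E k : k \in E -> dotv (u k) n2 = 0.
  by rewrite -aff0; apply: (edge_sum_eq0 hu hE iE); rewrite ?aff0 ?sum0.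
have uj : u j = u i - dotv (u i) n0 *: n0.
  by have [_ <-] := r0; have [_ <-] := hs0; rewrite s0i.
(* [n2] vanishes at both [u i] and [u j], which differ by a nonzero multiple of [n0]. *)
have n02 : dotv n0 n2 = 0.
  have := n2E j jE; rewrite uj dotvBl dotvZl w20 sub0r => /eqP.
  by rewrite oppr_eq0 mulf_eq0 -W0 (negbTE w00) => /eqP.
(* Otherwise [n1] would vanish at [i] and at its mirror image [j], hence on [E], against [w11]. *)
have n01 : dotv n0 n1 != 0.
  apply/negP => /eqP n01; move/negP: w11; apply; rewrite W1 -sum0 big1 // => k kE.
  apply: (edge_eq0 hu hE iE jE ji) => //; rewrite aff0 // uj dotvBl dotvZl n01 w10.
  by rewrite mulr0 subr0.
(* Otherwise [n2] would vanish on [E'], the image of [E], as well as on [E], hence on [F], against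
   [w22]. *)
have n12 : dotv n1 n2 != 0.
  apply/negP => /eqP n12; move/negP: w22; apply; rewrite W2 -sum0 big1 // => k kF.
  have n2E' x : x \in E' -> aff u (n2, 0) x = 0.
    apply: (edge_sum_eq0 hu hE' iE'); rewrite ?aff0 ?sum0 //.
    rewrite -s1E -(face_sum_image _ hs1); have [_ ->] := r1.
    by rewrite dotvBl dotvZl w21 n12 mulr0 subr0.
  have [y yE' yE] : exists2 y, y \in E' & y \notin E.
    apply/fintype.subsetPn; apply: contra EE' => sub.
    rewrite eq_sym eqEcard sub -s1E card_imset ?leqnn //; exact: perm_inj.
  apply: (facet_eq0 hE hF EF _ yE) => //; last exact: n2E'.
    exact: (fintype.subsetP EF').
  by move=> x xE; rewrite aff0 n2E.
have rot Q Q' n n' k : reflection n Q -> reflection n' Q' ->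
    \det (iter k (mulmx^~ (Q *m Q')) 1%:M) = 1 :> R.
  move=> /det_reflection dQ /det_reflection dQ'; apply: det_iter.
  by rewrite det_mulmx dQ dQ' mulrNN mulr1.
(* A trivial power of the permutation fixes the flag basis, so the corresponding matrix is the
   identity. *)
have order_iter s s' Q Q' k x : linear_symmetry u s Q -> linear_symmetry u s' Q' ->
    ((s * s') ^+ k = 1)%g -> iter k (fun y : 'rV[R]_3 => y *m Q *m Q') x = x.
  move=> hs hs' sk; have hk := linear_symmetryX k (linear_symmetryM hs hs').
  set M := iter k _ _ in hk; have [_ hM] := hk.
  have M1 : M = 1%:M.
    apply: (can_inj (mulKmx uW)); apply/row_matrixP; rewrite mulmx1.
    have fixA A : face_sum u A *m M = face_sum u A.
      rewrite (face_sum_image _ hk) sk; congr face_sum.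
      by rewrite (eq_imset (g := id)) ?imset_id // => y; rewrite perm1.
    apply: ord3; rewrite row_mul ?W0 ?W1 ?W2 ?fixA //.
    by rewrite -hM sk perm1.
  rewrite -[RHS]mulmx1 -M1 /M mulmx_iter; elim: {M sk hk hM M1} k => //= k ->.
  by rewrite mulmxA.
(* [s0 * s1] preserves [F], and a power of it fixing a vertex of [F] is a rotation preserving a flag
   vertex and its facet, hence trivial: the action on the [p] vertices is free. *)
have ord01 : ((s0 * s1) ^+ p = 1)%g.
  rewrite -(faces_p F hF); apply: (semiregular_card_dvd (to := 'P%act)).
    by move=> x xF /=; rewrite apermE permM -s1F -s0F !mem_imset //; exact: perm_inj.
  move=> k x xF /=; rewrite apermE => fx.
  have [D [_ [flx _ _]]] := two_edges hu hF xF.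
  have hk := linear_symmetryX k (linear_symmetryM hs0 hs1).
  apply: (rotation_fix_eq1 m0 hu cu flx hk) => //; first exact: rot r0 r1.
  elim: (k) => [|k' IH].
    by rewrite (eq_imset (g := id)) ?imset_id // => y; rewrite perm1.
  rewrite expgSr -[RHS]s1F -{2}s0F -{2}IH -!imset_comp.
  by apply: eq_imset => y; rewrite /= !permM.
(* The dual argument: [s1 * s2] fixes [i] and acts freely on the [q] facets through it. *)
have ord12 : ((s1 * s2) ^+ q = 1)%g.
  rewrite -(faces_q i); apply: (semiregular_card_dvd (to := ('P^*)%act)).
    move=> A; rewrite !inE => /andP[/asboolP hA iA]; apply/andP; split.
      apply/asboolP; have := face_image (linear_symmetryM hs1 hs2) hA.
      by congr face_of_dim; apply: eq_imset.
    rewrite /=; apply/imsetP; exists i => //=.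
    by rewrite apermE permM s1i s2i.
  move=> k A; rewrite !inE => /andP[/asboolP hA iA] fA.
  have [D [_ [flA _ _]]] := two_edges hu hA iA.
  have hk := linear_symmetryX k (linear_symmetryM hs1 hs2).
  apply: (rotation_fix_eq1 m0 hu cu flA hk) => //; first exact: rot r1 r2.
  elim: (k) => [|k' IH]; first by rewrite perm1.
  by rewrite expgSr permM IH permM s1i s2i.
exists s0, s1, s2, Q0, Q1, Q2, n0, n1, n2; split=> //; split=> //; split=> //.
- apply: (reflection_prod_order r0 r1 w00 _ w11 n01); first by rewrite W0.
  exact: order_iter hs0 hs1 ord01.
- apply: (reflection_prod_order r1 r2 w11 _ w22 n12); first by rewrite W1.
  exact: order_iter hs1 hs2 ord12.
- move=> x x0 x1 x2; have xE : x = (x *m invmx W) *m W by rewrite mulmxKV.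
  have c0 l : (x *m invmx W) 0 l = 0.
    have key n : dotv x n = \sum_k (x *m invmx W) 0 k * dotv (row k W) n.
      rewrite [in LHS]xE (mulmx_sum_row (x *m invmx W)) dotvC dotv_sumr.
      by apply: eq_bigr => k _; rewrite dotvZr dotvC.
    have dual n k : dotv x n = 0 -> dotv (row k W) n != 0 ->
        (forall k', k' != k -> dotv (row k' W) n = 0) -> (x *m invmx W) 0 k = 0.
      move=> xn wn zn; move: xn; rewrite key (bigD1 k) //= big1 ?addr0.
        by move/eqP; rewrite mulf_eq0 (negbTE wn) orbF => /eqP.
      by move=> k' /zn ->; rewrite mulr0.
    move: l; apply: ord3.
    - exact: dual x0 w00 w0.
    - exact: dual x1 w11 w1.
    - exact: dual x2 w22 w2.
  by rewrite xE; apply/rowP => l; rewrite mulmx_sum_row big1 // => k _; rewrite c0 scale0r.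
Qed.

End Flags.

(** * Moments of the vertices *)


Section Moments.
Context {R : realType} {m : nat}.
Implicit Types (u : 'I_m -> 'rV[R]_3) (n x y z w : 'rV[R]_3).

Definition mirror u n : Prop :=
  dotv n n = 2 /\
  exists s : {perm 'I_m}, forall i, u (s i) = u i - dotv (u i) n *: n.

Definition root_frame u n0 n1 n2 : Prop :=
  [/\ mirror u n0, mirror u n1 & mirror u n2] /\ dotv n0 n2 = 0 /\
  forall x, dotv x n0 = 0 -> dotv x n1 = 0 -> dotv x n2 = 0 -> x = 0.

Lemma mirror_sum u n (F : 'rV[R]_3 -> R) : mirror u n ->
  \sum_i F (u i) = \sum_i F (u i - dotv (u i) n *: n).
Proof.
move=> [_ [s hs]]; rewrite (reindex_inj (@perm_inj _ s)) /=.
by apply: eq_bigr => i _; rewrite hs.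
Qed.

(** The mirror negates u . n and turns u . x into u . x - (x . n)(u . n); the sum is added to its
    mirror image. *)
Lemma mirror_second_moment u n x : mirror u n ->
  2 * \sum_i dotv (u i) x * dotv (u i) n =
  dotv x n * \sum_i dotv (u i) n * dotv (u i) n.
Proof.
move=> hn; have [nn _] := hn; rewrite mulrDl mul1r.
rewrite {1}(@mirror_sum u n (fun v => dotv v x * dotv v n) hn) mulr_sumr -big_split /=.
apply: eq_bigr => i _; rewrite !dotvBl !dotvZl nn [dotv n x]dotvC; ring.
Qed.

(** Reading the mirror identity for two non-orthogonal roots in both of their mirrors shows that the
    moment form [B] takes equal values on them. Then [B x] and a multiple of the inner product with
    x agree on every root, and the roots separate vectors. *)
Lemma second_moment u n0 n1 n2 : root_frame u n0 n1 n2 ->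
  dotv n0 n1 != 0 -> dotv n1 n2 != 0 ->
  exists c, forall x y, \sum_i dotv (u i) x * dotv (u i) y = c * dotv x y.
Proof.
move=> [[h0 h1 h2] [n02 indep]] n01 n12.
pose B x y := \sum_i dotv (u i) x * dotv (u i) y.
have BC x y : B x y = B y x by apply: eq_bigr => i _; rewrite mulrC.
have B01 : B n0 n0 = B n1 n1.
  apply: (mulfI n01); rewrite -(mirror_second_moment n0 h1) [dotv n0 n1]dotvC.
  by rewrite -(mirror_second_moment n1 h0) -!/(B _ _) BC.
have B12 : B n1 n1 = B n2 n2.
  apply: (mulfI n12); rewrite -(mirror_second_moment n1 h2) [dotv n1 n2]dotvC.
  by rewrite -(mirror_second_moment n2 h1) -!/(B _ _) BC.
exists (B n0 n0 / 2) => x y.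
pose v := \sum_i dotv (u i) x *: u i.
have vE z : dotv v z = B x z.
  by rewrite dotvC dotv_sumr; apply: eq_bigr => i _; rewrite dotvZr [dotv z _]dotvC.
suff -> : \sum_i dotv (u i) x * dotv (u i) y = dotv ((B n0 n0 / 2) *: x) y by rewrite dotvZl.
rewrite -/(B x y) -vE; congr dotv; apply/eqP; rewrite -subr_eq0; apply/eqP.
have key n : mirror u n -> B n n = B n0 n0 -> dotv (v - (B n0 n0 / 2) *: x) n = 0.
  move=> hn Bn; have := mirror_second_moment x hn; rewrite -!/(B _ _) Bn => e.
  by rewrite dotvBl dotvZl vE; lra.
by apply: indep; apply: key => //; rewrite -?B12 -?B01.
Qed.

Definition moment4 u x y z w : R :=
  \sum_i dotv (u i) x * dotv (u i) y * (dotv (u i) z * dotv (u i) w).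

(** Mirror invariance gives linear equations between the fifteen quartic moments [T j k l], leaving
    only [T 4 0 0] free. The quartic form is thereby known, and polarization recovers [moment4],
    with factor 192 = 8 * 4!. *)
Lemma fourth_moment u n0 n1 n2 : root_frame u n0 n1 n2 ->
  dotv n0 n1 != 0 -> dotv n1 n2 != 0 ->
  dotv n0 n1 ^+ 2 != 2 -> dotv n1 n2 ^+ 2 != 2 ->
  (dotv n0 n1 ^+ 2 != 1) || (dotv n1 n2 ^+ 2 != 1) ->
  exists c, forall x y z w, moment4 u x y z w =
    c * (dotv x y * dotv z w + dotv x z * dotv y w + dotv x w * dotv y z).
Proof.
move=> [[h0 h1 h2] [n02 indep]].
pose T j k l := \sum_i dotv (u i) n0 ^+ j * dotv (u i) n1 ^+ k * dotv (u i) n2 ^+ l.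
have [[n00 _] [n11 _] [n22 _]] := And3 h0 h1 h2.
set a := dotv n0 n1; set b := dotv n1 n2 => a0 b0 a2 b2 ab.
have T0 j k l : T j k l = \sum_i (- dotv (u i) n0) ^+ j *
    (dotv (u i) n1 - a * dotv (u i) n0) ^+ k * dotv (u i) n2 ^+ l.
  rewrite /T (@mirror_sum u n0 (fun v => dotv v n0 ^+ j * dotv v n1 ^+ k * dotv v n2 ^+ l)) //.
  apply: eq_bigr => i _; rewrite !dotvBl !dotvZl n00 n02 mulr0 subr0.
  by congr (_ ^+ _ * _ ^+ _ * _); rewrite /a; ring.
have T1 j k l : T j k l = \sum_i (dotv (u i) n0 - a * dotv (u i) n1) ^+ j *
    (- dotv (u i) n1) ^+ k * (dotv (u i) n2 - b * dotv (u i) n1) ^+ l.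
  rewrite /T (@mirror_sum u n1 (fun v => dotv v n0 ^+ j * dotv v n1 ^+ k * dotv v n2 ^+ l)) //.
  apply: eq_bigr => i _; rewrite !dotvBl !dotvZl n11 [dotv n1 n0]dotvC -/a -/b.
  by congr (_ ^+ _ * _ ^+ _ * _ ^+ _); ring.
have T2 j k l : T j k l = \sum_i dotv (u i) n0 ^+ j *
    (dotv (u i) n1 - b * dotv (u i) n2) ^+ k * (- dotv (u i) n2) ^+ l.
  rewrite /T (@mirror_sum u n2 (fun v => dotv v n0 ^+ j * dotv v n1 ^+ k * dotv v n2 ^+ l)) //.
  apply: eq_bigr => i _; rewrite !dotvBl !dotvZl n22 [dotv n2 n0]dotvC n02 mulr0 subr0.
  by rewrite [dotv n2 n1]dotvC -/b; congr (_ * _ ^+ _ * _ ^+ _); ring.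
(* The equations named with e come from the mirrors of [n0] and [n2], those named with f from the
   mirror of [n1]. *)
have e301 : T 3 0 1 = -1 * T 3 0 1.
  rewrite [LHS]T0 /T !mulr_sumr -?big_split /=; apply: eq_bigr => i _; ring.
have e103 : T 1 0 3 = -1 * T 1 0 3.
  rewrite [LHS]T0 /T !mulr_sumr -?big_split /=; apply: eq_bigr => i _; ring.
have e310 : T 3 1 0 = -1 * T 3 1 0 + a * T 4 0 0.
  rewrite [LHS]T0 /T !mulr_sumr -?big_split /=; apply: eq_bigr => i _; ring.
have e130 : T 1 3 0 = -1 * T 1 3 0 + (3 * a) * T 2 2 0 + (- 3 * a ^+ 2) * T 3 1 0 +
    (a ^+ 3) * T 4 0 0.
  rewrite [LHS]T0 /T !mulr_sumr -?big_split /=; apply: eq_bigr => i _; ring.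
have e112 : T 1 1 2 = -1 * T 1 1 2 + a * T 2 0 2.
  rewrite [LHS]T0 /T !mulr_sumr -?big_split /=; apply: eq_bigr => i _; ring.
have e013 : T 0 1 3 = -1 * T 0 1 3 + b * T 0 0 4.
  rewrite [LHS]T2 /T !mulr_sumr -?big_split /=; apply: eq_bigr => i _; ring.
have e031 : T 0 3 1 = -1 * T 0 3 1 + (3 * b) * T 0 2 2 + (- 3 * b ^+ 2) * T 0 1 3 +
    (b ^+ 3) * T 0 0 4.
  rewrite [LHS]T2 /T !mulr_sumr -?big_split /=; apply: eq_bigr => i _; ring.
have e211 : T 2 1 1 = -1 * T 2 1 1 + b * T 2 0 2.
  rewrite [LHS]T2 /T !mulr_sumr -?big_split /=; apply: eq_bigr => i _; ring.
have e121 : T 1 2 1 = -1 * T 1 2 1 + (2 * b) * T 1 1 2 + (- b ^+ 2) * T 1 0 3.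
  rewrite [LHS]T2 /T !mulr_sumr -?big_split /=; apply: eq_bigr => i _; ring.
have f130 : T 1 3 0 = -1 * T 1 3 0 + a * T 0 4 0.
  rewrite [LHS]T1 /T !mulr_sumr -?big_split /=; apply: eq_bigr => i _; ring.
have f031 : T 0 3 1 = -1 * T 0 3 1 + b * T 0 4 0.
  rewrite [LHS]T1 /T !mulr_sumr -?big_split /=; apply: eq_bigr => i _; ring.
have f310 : T 3 1 0 = -1 * T 3 1 0 + (3 * a) * T 2 2 0 + (- 3 * a ^+ 2) * T 1 3 0 +
    (a ^+ 3) * T 0 4 0.
  rewrite [LHS]T1 /T !mulr_sumr -?big_split /=; apply: eq_bigr => i _; ring.
have f013 : T 0 1 3 = -1 * T 0 1 3 + (3 * b) * T 0 2 2 + (- 3 * b ^+ 2) * T 0 3 1 +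
    (b ^+ 3) * T 0 4 0.
  rewrite [LHS]T1 /T !mulr_sumr -?big_split /=; apply: eq_bigr => i _; ring.
have f211 : T 2 1 1 = -1 * T 2 1 1 + b * T 2 2 0 + (2 * a) * T 1 2 1 +
    (- 2 * a * b) * T 1 3 0 + (- a ^+ 2) * T 0 3 1 + (a ^+ 2 * b) * T 0 4 0.
  rewrite [LHS]T1 /T !mulr_sumr -?big_split /=; apply: eq_bigr => i _; ring.
have f112 : T 1 1 2 = -1 * T 1 1 2 + a * T 0 2 2 + (2 * b) * T 1 2 1 +
    (- 2 * a * b) * T 0 3 1 + (- b ^+ 2) * T 1 3 0 + (a * b ^+ 2) * T 0 4 0.
  rewrite [LHS]T1 /T !mulr_sumr -?big_split /=; apply: eq_bigr => i _; ring.
have cancel (x y z : R) : x != 0 -> x * (y - z) = 0 -> y = z.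
  by move=> x0 /eqP; rewrite mulf_eq0 (negbTE x0) subr_eq0 => /eqP.
have g310 : T 3 1 0 = a / 2 * T 4 0 0 by lra.
have g130 : T 1 3 0 = a / 2 * T 0 4 0 by lra.
have g031 : T 0 3 1 = b / 2 * T 0 4 0 by lra.
have g013 : T 0 1 3 = b / 2 * T 0 0 4 by lra.
have g112 : T 1 1 2 = a / 2 * T 2 0 2 by lra.
have g211 : T 2 1 1 = b / 2 * T 2 0 2 by lra.
have g103 : T 1 0 3 = 0 by lra.
have g301 : T 3 0 1 = 0 by lra.
have g121 : T 1 2 1 = a * b / 2 * T 2 0 2.
  by rewrite g112 g103 in e121; lra.
(* Subtracting [f310] from [e130] eliminates [T 2 2 0] and leaves the factor a (2 - a^2): here the
   angle of order 4 is excluded. *)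
have g040 : T 0 4 0 = T 4 0 0.
  apply: (@cancel (a * (2 - a ^+ 2))); first by rewrite mulf_neq0 // subr_eq0 eq_sym.
  by move: e130 f310; rewrite g310 g130; lra.
have g004 : T 0 0 4 = T 4 0 0.
  rewrite -g040; apply: (@cancel (b * (2 - b ^+ 2))).
    by rewrite mulf_neq0 // subr_eq0 eq_sym.
  by move: e031 f013; rewrite g031 g013; lra.
have g220 : T 2 2 0 = (2 + a ^+ 2) / 6 * T 4 0 0.
  by apply: (cancel a) => //; move: e130; rewrite g310 g130 g040; lra.
have g022 : T 0 2 2 = (2 + b ^+ 2) / 6 * T 4 0 0.
  by apply: (cancel b) => //; move: e031; rewrite g031 g013 g040 g004; lra.
(* [f211] yields the factor 1 - a^2 and [f112] the factor 1 - b^2; one of them is nonzero. *)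
have g202 : T 2 0 2 = T 4 0 0 / 3.
  case/orP: ab => ab.
    apply: (@cancel (b * (1 - a ^+ 2))); first by rewrite mulf_neq0 // subr_eq0 eq_sym.
    by move: f211; rewrite g211 g121 g130 g031 g040 g220; lra.
  apply: (@cancel (a * (1 - b ^+ 2))); first by rewrite mulf_neq0 // subr_eq0 eq_sym.
  by move: f112; rewrite g112 g121 g130 g031 g040 g022; lra.
(* For x = n0, where n0 . n0 = 2, the identity [quartic] below reads [T 4 0 0 = 12 * c]. *)
pose c := T 4 0 0 / 12; exists c.
have cE : T 4 0 0 = 12 * c by rewrite /c; field.
have quartic x : \sum_i dotv (u i) x ^+ 4 = 3 * c * dotv x x ^+ 2.
  pose N : 'M[R]_3 := \matrix_(k < 3) nth 0 [:: n0; n1; n2] k.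
  have uN : N \in unitmx.
    rewrite -unitmx_tr -row_free_unit; apply: inj_row_free => v /(congr1 trmx).
    rewrite trmx_mul trmxK trmx0 => Nv.
    have dN k : dotv v (row k N) = 0.
      by rewrite dotvC /dotv -row_mul Nv row0 mxE.
    apply: indep; [have := dN 0|have := dN 1|have := dN 2%:R]; by rewrite rowK.
  have -> : x = (x *m invmx N) *m N by rewrite mulmxKV.
  rewrite (mulmx_sum_row (x *m invmx N)) !big_ord_recl big_ord0 addr0 !rowK /=.
  move: ((x *m invmx N) 0 _) => y0; move: ((x *m invmx N) 0 _) => y1.
  move: ((x *m invmx N) 0 _) => y2.
  have expand : \sum_i dotv (u i) (y0 *: n0 + (y1 *: n1 + y2 *: n2)) ^+ 4 = (
    y0 ^+ 4 * T 4 0 0 + 4 * y0 ^+ 3 * y1 * T 3 1 0 + 4 * y0 ^+ 3 * y2 * T 3 0 1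
    + 6 * y0 ^+ 2 * y1 ^+ 2 * T 2 2 0 + 12 * y0 ^+ 2 * y1 * y2 * T 2 1 1
    + 6 * y0 ^+ 2 * y2 ^+ 2 * T 2 0 2 + 4 * y0 * y1 ^+ 3 * T 1 3 0
    + 12 * y0 * y1 ^+ 2 * y2 * T 1 2 1 + 12 * y0 * y1 * y2 ^+ 2 * T 1 1 2
    + 4 * y0 * y2 ^+ 3 * T 1 0 3 + y1 ^+ 4 * T 0 4 0 + 4 * y1 ^+ 3 * y2 * T 0 3 1
    + 6 * y1 ^+ 2 * y2 ^+ 2 * T 0 2 2 + 4 * y1 * y2 ^+ 3 * T 0 1 3 + y2 ^+ 4 * T 0 0 4).
    rewrite /T !mulr_sumr -!big_split /=; apply: eq_bigr => i _.
    by rewrite !dotvDr !dotvZr; ring.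
  rewrite expand g310 g301 g220 g211 g130 g121 g112 g103 g031 g022 g013 g004 g202 g040 cE.
  rewrite !dotvDr !dotvZr !dotvDl !dotvZl n00 n11 n22 n02.
  rewrite [dotv n1 n0]dotvC [dotv n2 n0]dotvC [dotv n2 n1]dotvC n02 -/a -/b.
  by field.
move=> x y z w; pose q v := \sum_i dotv (u i) v ^+ 4.
(* polarization *)
have pol : 192 * moment4 u x y z w =
    q (x + y + z + w) - q (x + y + z - w) - q (x + y - z + w) + q (x + y - z - w)
    - q (x - y + z + w) + q (x - y + z - w) + q (x - y - z + w) - q (x - y - z - w).
  rewrite /q /moment4 mulr_sumr -!(sumrB, big_split) /=; apply: eq_bigr => i _.
  by rewrite !(dotvDr, dotvNr); ring.
move: pol; rewrite /q !quartic !(dotvDr, dotvNr, dotvDl, dotvNl).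
rewrite [dotv y x]dotvC [dotv z x]dotvC [dotv w x]dotvC [dotv z y]dotvC.
rewrite [dotv w y]dotvC [dotv w z]dotvC => pol.
by apply: (@cancel 192); [rewrite pnatr_eq0 | rewrite mulrBr pol; ring].
Qed.

(** The characteristic polynomial of the product is X^3 - c X^2 - c X + 1; the identity is checked
    by pairing with the three roots. *)
Lemma coxeter_cayley_hamilton n0 n1 n2 (Q0 Q1 Q2 : 'M[R]_3) x :
  reflection n0 Q0 -> reflection n1 Q1 -> reflection n2 Q2 -> dotv n0 n2 = 0 ->
  (forall x, dotv x n0 = 0 -> dotv x n1 = 0 -> dotv x n2 = 0 -> x = 0) ->
  let c := dotv n0 n1 ^+ 2 + dotv n1 n2 ^+ 2 - 3 in
  let f (v : 'rV[R]_3) : 'rV[R]_3 := v *m Q0 *m Q1 *m Q2 in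
  f (f (f x)) = c *: f (f x) + c *: f x - x.
Proof.
move=> [n00 h0] [n11 h1] [n22 h2] n02 indep.
set a := dotv n0 n1; set b := dotv n1 n2 => c f.
have fE v : f v = v - dotv v n0 *: n0 - (dotv v n1 - a * dotv v n0) *: n1
    - (dotv v n2 - b * (dotv v n1 - a * dotv v n0)) *: n2.
  rewrite /f h0 h1 h2 !(dotvBl, dotvZl) n02 -/a -/b.
  by apply/rowP => j; rewrite !mxE; ring.
have f0 v : dotv (f v) n0 = - dotv v n0 - a * (dotv v n1 - a * dotv v n0).
  rewrite fE !(dotvBl, dotvZl) n00 [dotv n1 n0]dotvC [dotv n2 n0]dotvC n02 -/a; ring.
have f1 v : dotv (f v) n1 = - dotv v n1 + a * dotv v n0
   - b * (dotv v n2 - b * (dotv v n1 - a * dotv v n0)).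
  rewrite fE !(dotvBl, dotvZl) n11 [dotv n2 n1]dotvC -/a -/b; ring.
have f2 v : dotv (f v) n2 = - dotv v n2 + b * (dotv v n1 - a * dotv v n0).
  rewrite fE !(dotvBl, dotvZl) n22 n02 -/b; ring.
apply/eqP; rewrite -subr_eq0; apply/eqP; apply: indep;
  rewrite !(dotvBl, dotvDl, dotvZl) !(f0, f1, f2) /c; ring.
Qed.

End Moments.

(** * Symmetry of second derivatives *)


Section Smooth.
Context {R : realType}.
Implicit Types (f g : 'rV[R]_3 -> R) (u v x : 'rV[R]_3).

Lemma smooth_differentiable f x : smooth f -> differentiable f x.
Proof. by move=> /(_ 1%N) []. Qed.

Lemma smooth_dirD v f : smooth f -> smooth (dirD v f).
Proof. by move=> hf n; have [_] := hf n.+1; apply. Qed.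

Lemma dirD_coord v f : smooth f ->
  dirD v f = fun x => \sum_j v 0 j * dirD (delta_mx 0 j) f x.
Proof.
move=> hf; apply/funext => x; have df := smooth_differentiable x hf.
rewrite /dirD deriveE // {1}(row_sum_delta v) linear_sum /=.
by apply: eq_bigr => j _; rewrite linearZ /= deriveE.
Qed.

Lemma is_derive_line f x u (s : R) : differentiable f (x + s *: u) ->
  is_derive s 1 (fun r : R => f (x + r *: u)) ('D_u f (x + s *: u)).
Proof.
move=> df; have du : derivable f (x + s *: u) u by exact: diff_derivable.
have E : (fun h : R => h^-1 *: (f (x + (h *: 1 + s) *: u) - f (x + s *: u))) =
         (fun h : R => h^-1 *: (f (h *: u + (x + s *: u)) - f (x + s *: u))).
  apply/funext => h; congr (_ *: (f _ - _)).
  by rewrite [h *: 1]mulr1 scalerDl addrCA.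
by split; rewrite /derivable /derive E.
Qed.

Lemma MVT_line f x u (h : R) : (forall y, differentiable f y) -> 0 < h ->
  exists2 s, 0 < s < h & f (x + h *: u) - f x = h * 'D_u f (x + s *: u).
Proof.
move=> df h0.
have dl (s : R) : is_derive s 1 (fun r : R => f (x + r *: u)) ('D_u f (x + s *: u)).
  exact: is_derive_line.
have [|s sh] := @MVT _ (fun r : R => f (x + r *: u))
  (fun s => 'D_u f (x + s *: u)) 0 h h0 (fun s _ => dl s).
  by apply: derivable_within_continuous => s _; have [] := dl s.
by rewrite scale0r addr0 subr0 mulrC => e; exists s.
Qed.

(** The mean value theorem is applied along [u] to the increment of [f] by [h *: v], then along [v]
    to ['D_u f]. *)
Lemma second_difference f x u v (h : R) : smooth f -> 0 < h ->
  exists s t, [/\ 0 < s < h, 0 < t < h &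
    f (x + h *: u + h *: v) - f (x + h *: u) - f (x + h *: v) + f x =
    h * h * dirD v (dirD u f) (x + s *: u + t *: v)].
Proof.
move=> hf h0; have df y := smooth_differentiable y hf.
pose F := (f \o shift (h *: v)) - f.
have dsh y : differentiable (f \o shift (h *: v)) y.
  by apply: differentiable_comp => //; exact: df.
have dF y : differentiable F y by apply: differentiableB.
have [s sh Fs] := @MVT_line F x u h dF h0.
have DF y : 'D_u F y = 'D_u f (y + h *: v) - 'D_u f y.
  have d1 : derivable (f \o shift (h *: v)) y u by apply: diff_derivable; exact: dsh.
  have d2 : derivable f y u by apply: diff_derivable; exact: df.
  rewrite deriveB //.
  congr (_ - _).
  have E : (fun r : R => r^-1 *:
        (((f \o shift (h *: v)) \o shift y) (r *: u) - (f \o shift (h *: v)) y)) =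
      (fun r : R => r^-1 *: ((f \o shift (y + h *: v)) (r *: u) - f (y + h *: v))).
    by apply/funext => r /=; rewrite addrA.
  by rewrite /derive E.
have [t th ft] := MVT_line (x + s *: u) v
  (fun y => smooth_differentiable y (smooth_dirD u hf)) h0.
exists s, t; split=> //.
have -> : f (x + h *: u + h *: v) - f (x + h *: u) - f (x + h *: v) + f x =
    F (x + h *: u) - F x.
  rewrite /F !fctE /= ; ring.
by rewrite Fs DF ft mulrA.
Qed.

Lemma smooth_near f x u v (e : R) : smooth f -> 0 < e ->
  exists2 d, 0 < d & forall s t, 0 < s < d -> 0 < t < d ->
    `|f x - f (x + s *: u + t *: v)| < e.
Proof.
move=> hf e0; have := smooth_differentiable x hf.
move=> /differentiable_continuous/cvgrPdist_lt/(_ e e0).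
move=> /nbhs_normP[r r0 hr].
exists (r / (`|u| + `|v| + 1)) => [|s t /andP[s0 sd] /andP[t0 td]].
  by rewrite divr_gt0 // ltr_wpDl.
apply: hr => /=; rewrite opprD addrA opprD addrA subrr add0r.
have p : 0 < `|u| + `|v| + 1 by rewrite ltr_wpDl.
apply: le_lt_trans (ler_normB _ _) _; rewrite normrN !normrZ !gtr0_norm //.
set d := r / _ in sd td.
have dE : d * (`|u| + `|v| + 1) = r by rewrite /d divfK // lt0r_neq0.
have d0 : 0 < d by apply: lt_trans sd.
have su : s * `|u| <= d * `|u| by rewrite ler_wpM2r // ltW.
have tv : t * `|v| <= d * `|v| by rewrite ler_wpM2r // ltW.
by move: dE; rewrite !mulrDr mulr1 => <-; rewrite -[ltLHS]addr0 ler_ltD // lerD.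
Qed.

Lemma dist_le_split (e p q r : R) :
  `|p - r| < e / 2 -> `|q - r| < e / 2 -> `|p - q| <= e.
Proof.
move=> pr qr; have -> : p - q = (p - r) - (q - r) by ring.
by apply: le_trans (ler_normB _ _) _; rewrite (splitr e) lerD // ltW.
Qed.

Lemma second_difference_inj (h p q r w a b : R) : 0 < h ->
  p - q - r + w = h * h * a -> p - r - q + w = h * h * b -> b = a.
Proof.
move=> h0 ea eb; apply: (@mulfI _ (h * h)); first by rewrite mulf_neq0 // lt0r_neq0.
by rewrite -ea -eb; ring.
Qed.

(** Schwarz's theorem: the second difference is symmetric in [u] and [v], and equals h^2 times each
    mixed derivative at a point tending to [x] with h; both are continuous. *)
Lemma dirDC f u v : smooth f -> dirD u (dirD v f) = dirD v (dirD u f).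
Proof.
move=> hf; apply/funext => x; apply/eqP; rewrite -subr_eq0 -normr_eq0 eq_le normr_ge0 andbT.
apply/ler_addgt0Pr => e e0; rewrite add0r.
have e2 : 0 < e / 2 by rewrite divr_gt0.
have [d1 d10 h1] :=
  @smooth_near (dirD u (dirD v f)) x v u (e / 2) (smooth_dirD u (smooth_dirD v hf)) e2.
have [d2 d20 h2] :=
  @smooth_near (dirD v (dirD u f)) x u v (e / 2) (smooth_dirD v (smooth_dirD u hf)) e2.
pose h := Num.min d1 d2; have h0 : 0 < h by rewrite lt_min d10.
have [s [t [sh th E]]] := second_difference x u v hf h0.
have [s' [t' [sh' th' E']]] := second_difference x v u hf h0.
have lt1 r : 0 < r < h -> 0 < r < d1.
  by move=> /andP[-> rh]; apply: lt_le_trans rh _; rewrite ge_min lexx.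
have lt2 r : 0 < r < h -> 0 < r < d2.
  by move=> /andP[-> rh]; apply: lt_le_trans rh _; rewrite ge_min lexx orbT.
have {}h1 := h1 _ _ (lt1 _ sh') (lt1 _ th'); have {}h2 := h2 _ _ (lt2 _ sh) (lt2 _ th).
have EE : dirD u (dirD v f) (x + s' *: v + t' *: u) = dirD v (dirD u f) (x + s *: u + t *: v).
  by rewrite (addrAC x (h *: v)) in E'; exact: (second_difference_inj h0 E E').
by rewrite -EE in h2; exact: dist_le_split h1 h2.
Qed.

End Smooth.

(** * Symmetric polynomials and their action on smooth functions *)


Section ElementarySymmetric.
Context {A : comNzRingType} {m : nat}.
Implicit Types (y : 'I_m -> A).

Definition elsym (r : nat) y : A :=
  \sum_(S : {set 'I_m} | #|S| == r) \prod_(i in S) y i.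

Definition psum (k : nat) y : A := \sum_i y i ^+ k.

Lemma elsym_perm r y (s : {perm 'I_m}) : elsym r (y \o s) = elsym r y.
Proof.
rewrite /elsym [RHS](reindex_inj (imset_inj (@perm_inj _ s))) /=.
apply: eq_big => S; first by rewrite card_imset //; exact: perm_inj.
by move=> _; rewrite big_imset //= => i j _ _; apply: perm_inj.
Qed.

Lemma elsymN r y : elsym r (fun i => - y i) = (-1) ^+ r * elsym r y.
Proof.
rewrite /elsym mulr_sumr; apply: eq_bigr => S /eqP <-.
by rewrite prodrN.
Qed.

(** Removing [i] from [S] moves one factor [y i] into the power. *)
Lemma elsym_incident (k r : nat) y :
  \sum_i \sum_(S : {set 'I_m} | (#|S| == r.+1) && (i \in S)) y i ^+ k * \prod_(j in S) y j =
  \sum_i \sum_(S : {set 'I_m} | (#|S| == r) && (i \notin S)) y i ^+ k.+1 * \prod_(j in S) y j.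
Proof.
apply: eq_bigr => i _.
rewrite (reindex_onto (fun S => i |: S) (fun S => S :\ i)) /=; last first.
  by move=> S /andP[_ iS]; rewrite finset.setD1K.
apply: eq_big => [S|S /andP[/andP[_ _] /eqP iS]].
  rewrite setU11 andbT; have [iS|iS] := boolP (i \in S).
    rewrite andbF; apply/negP => /andP[_ /eqP E].
    by move: iS; rewrite -E !inE eqxx.
  by rewrite setU1K // eqxx !andbT cardsU1 iS.
have {}iS : i \notin S by rewrite -iS !inE eqxx.
by rewrite big_setU1 //= exprSr mulrA.
Qed.

(** Telescoping form of Newton's identities. Let h(k, r) be the sum of [y i ^+ k] times the product
    over [S], for |S| = r and i outside S; the terms with i in S contribute h(k+1, r), the others
    h(k, r+1). *)
Lemma newton_step (k r : nat) y :
  psum k y * elsym r.+1 y =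
  \sum_i \sum_(S : {set 'I_m} | (#|S| == r) && (i \notin S)) y i ^+ k.+1 * \prod_(j in S) y j +
  \sum_i \sum_(S : {set 'I_m} | (#|S| == r.+1) && (i \notin S)) y i ^+ k * \prod_(j in S) y j.
Proof.
rewrite -elsym_incident -big_split /= /psum mulr_suml; apply: eq_bigr => i _.
by rewrite /elsym mulr_sumr [LHS](bigID (fun S : {set 'I_m} => i \in S)).
Qed.

Lemma newton_diag (r : nat) y :
  \sum_i \sum_(S : {set 'I_m} | (#|S| == r) && (i \notin S)) y i ^+ 1 * \prod_(j in S) y j
  = r.+1%:R * elsym r.+1 y.
Proof.
rewrite -(elsym_incident 0) (exchange_big_dep (fun S : {set 'I_m} => #|S| == r.+1)) /=;
  last first.
  by move=> i S _ /andP[].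
rewrite /elsym mulr_sumr; apply: eq_bigr => S /eqP cS.
transitivity (\sum_(i in S) \prod_(j in S) y j).
  by apply: eq_big => [i|i _]; rewrite ?cS ?eqxx // expr0 mul1r.
by rewrite sumr_const cS mulr_natl.
Qed.

Lemma newton_top (k : nat) y :
  \sum_i \sum_(S : {set 'I_m} | (#|S| == 0)%N && (i \notin S)) y i ^+ k * \prod_(j in S) y j
  = psum k y.
Proof.
apply: eq_bigr => i _; rewrite (big_pred1 finset.set0) => [|S].
  by rewrite big_set0 mulr1.
rewrite cards_eq0 andb_idr // => /eqP->; by rewrite inE.
Qed.

Lemma elsym1 y : elsym 1 y = psum 1 y.
Proof. by have := newton_diag 0 y; rewrite newton_top mul1r => ->. Qed.

Lemma elsym2 y : psum 1 y = 0 -> 2 * elsym 2 y = - psum 2 y.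
Proof.
move=> p1; have := newton_step 1 0 y; rewrite (newton_diag 1) newton_top p1 mul0r.
by move/(@Logic.eq_sym _ _ _)/eqP; rewrite addrC addr_eq0 => /eqP.
Qed.

(** With h as for [newton_step]: 0 = p1 e3 = h(2,2) + 4 e4, p2 e2 = h(3,1) + h(2,2) and 0 = p3 e1 =
    p4 + h(3,1); the h terms are eliminated. *)
Lemma elsym4 y : psum 1 y = 0 -> psum 3 y = 0 ->
  8 * elsym 4 y = psum 2 y ^+ 2 - 2 * psum 4 y.
Proof.
move=> p1 p3; have e2 := elsym2 p1.
have := newton_step 1 2 y; rewrite (newton_diag 3) p1 mul0r.
have := newton_step 2 1 y; have := newton_step 3 0 y.
rewrite newton_top p3 mul0r.
set h31 := (X in 0 = _ + X -> _) => ha; rewrite -/h31.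
set h22 := (X in _ = _ + X -> _) => hb; rewrite -/h22 => hc.
have h31E : h31 = - psum 4 y by apply/eqP; rewrite -addr_eq0 addrC -ha.
have h22E : h22 = - (4 * elsym 4 y) by apply/eqP; rewrite -addr_eq0 -hc.
have : psum 2 y * (2 * elsym 2 y) = 2 * (h31 + h22) by rewrite -hb; ring.
rewrite e2 h31E h22E => E.
have -> : 8 * elsym 4 y = - (2 * (- psum 4 y + - (4 * elsym 4 y))) - 2 * psum 4 y by ring.
by rewrite -E; ring.
Qed.

(** Permuting the arguments negates them all, so e_r equals (-1)^r e_r. *)
Lemma elsym_odd_eq0 r y (s : {perm 'I_m}) : (forall x : A, x + x = 0 -> x = 0) ->
  odd r -> (forall i, y (s i) = - y i) -> elsym r y = 0.
Proof.
move=> two_reg r_odd ys; apply: two_reg; rewrite -{1}(elsym_perm r y s).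
have -> : elsym r (y \o s) = elsym r (fun i => - y i).
  by apply: eq_bigr => S _; apply: eq_bigr => i _; rewrite /= ys.
by rewrite elsymN -signr_odd r_odd mulN1r addNr.
Qed.

End ElementarySymmetric.

(** * Polynomials as differential operators with constant coefficients *)

Section PolynomialAction.
Context {R : realType}.
Implicit Types (f g : 'rV[R]_3 -> R) (u v x : 'rV[R]_3).
Notation poly3 := (mpoly.mpoly 3 R).

Definition partial (j : 'I_3) : operator R := dirD (delta_mx 0 j).

Definition partials (k : mpoly.multinom 3) (f : 'rV[R]_3 -> R) : 'rV[R]_3 -> R :=
  iter (mpoly.fun_of_multinom k ord0) (partial ord0)
    (iter (mpoly.fun_of_multinom k (inord 1)) (partial (inord 1))
    (iter (mpoly.fun_of_multinom k (inord 2)) (partial (inord 2)) f)).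

(* p |-> (p(d/dx_0, d/dx_1, d/dx_2) f)(x) *)
Definition symbol_eval f x (p : poly3) : R :=
  freeg.fglift (fun k : mpoly.multinom 3 => partials k f x : R^o) (mpoly.mpoly_val p).

Lemma symbol_evalB f x : {morph symbol_eval f x : p q / p - q}.
Proof. by move=> p q; rewrite /symbol_eval -freeg.lift_is_additive. Qed.

Lemma symbol_evalD f x : {morph symbol_eval f x : p q / p + q}.
Proof.
have e0 : symbol_eval f x 0 = 0 by rewrite -(subrr 0) symbol_evalB subrr.
have eN q : symbol_eval f x (- q) = - symbol_eval f x q.
  by rewrite -sub0r symbol_evalB e0 sub0r.
by move=> p q; rewrite -{1}[q]opprK symbol_evalB eN opprK.
Qed.

Lemma symbol_evalX f x c k :
  symbol_eval f x (c *: mpoly.mpolyX R k) = c * partials k f x.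
Proof.
by rewrite -mpoly.MPolyU /symbol_eval freeg.liftU.
Qed.

Lemma symbol_eval0 f x : symbol_eval f x 0 = 0.
Proof. by rewrite -(subrr 0) symbol_evalB subrr. Qed.

Lemma symbol_evalZ f x c p : symbol_eval f x (c *: p) = c * symbol_eval f x p.
Proof.
elim/mpoly.mpolyind: p => [|d k p _ _ IH]; first by rewrite scaler0 symbol_eval0 mulr0.
by rewrite scalerDr !symbol_evalD IH scalerA !symbol_evalX mulrDr mulrA.
Qed.

Lemma symbol_eval_sum f x (I : Type) (r : seq I) (P : pred I) (F : I -> poly3) :
  symbol_eval f x (\sum_(i <- r | P i) F i) =
  \sum_(i <- r | P i) symbol_eval f x (F i).
Proof. exact: (big_morph _ (symbol_evalD f x) (symbol_eval0 f x)). Qed.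

Lemma smooth_iter n v f : smooth f -> smooth (iter n (dirD v) f).
Proof. by move=> hf; elim: n => //= n; apply: smooth_dirD. Qed.

Lemma iter_dirDC n u v f : smooth f ->
  iter n (dirD u) (dirD v f) = dirD v (iter n (dirD u) f).
Proof.
by move=> hf; elim: n => //= n ->; rewrite dirDC //; apply: smooth_iter.
Qed.

Lemma dirD2C u v f : smooth f ->
  dirD u (dirD u (dirD v (dirD v f))) = dirD v (dirD v (dirD u (dirD u f))).
Proof.
move=> hf; have hv := smooth_dirD v hf.
rewrite -[LHS]/(iter 2 (dirD u) (dirD v (dirD v f))) (iter_dirDC 2 u v hv).
by rewrite (iter_dirDC 2 u v hf).
Qed.

Lemma smooth_partials k f : smooth f -> smooth (partials k f).
Proof. by move=> hf; do !apply: smooth_iter. Qed.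

Lemma partials_dirD k v f : smooth f ->
  partials k (dirD v f) = dirD v (partials k f).
Proof.
move=> hf; rewrite /partials /partial.
by rewrite !iter_dirDC //; do !apply: smooth_iter.
Qed.

Lemma partialsU j k f : smooth f ->
  partials (mpoly.mnm_add (mpoly.mnm1 j) k) f = partials k (partial j f).
Proof.
move=> hf; rewrite partials_dirD // /partials !mpoly.mnmDE !mpoly.mnm1E.
have : j = ord0 \/ j = inord 1 \/ j = inord 2.
  case: j => [[|[|[|j]]] hj] //; [left|right; left|right; right];
  by apply: val_inj; rewrite /= ?inordK.
have n01 : (ord0 == inord 1 :> 'I_3) = false by rewrite -val_eqE /= inordK.
have n02 : (ord0 == inord 2 :> 'I_3) = false by rewrite -val_eqE /= inordK.
have n12 : (inord 1 == inord 2 :> 'I_3) = false by rewrite -val_eqE /= !inordK.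
have nE := (n01, n02, n12, etrans (eq_sym _ _) n01, etrans (eq_sym _ _) n02,
  etrans (eq_sym _ _) n12).
case=> [->|[->|->]]; rewrite !eqxx !nE ?add0n ?add1n //= /partial.
- by rewrite iter_dirDC //; do !apply: smooth_iter.
- by rewrite !iter_dirDC //; do !apply: smooth_iter.
Qed.

Definition var j : poly3 := mpoly.mpolyX R (mpoly.mnm1 j).

Lemma symbol_evalMvar f x j p : smooth f ->
  symbol_eval f x (var j * p) = symbol_eval (partial j f) x p.
Proof.
move=> hf; elim/mpoly.mpolyind: p => [|c k p _ _ IH].
  by rewrite mulr0 !symbol_eval0.
rewrite mulrDr !symbol_evalD IH -scalerAr -mpoly.mpolyXD !symbol_evalX.
by rewrite partialsU.
Qed.

Definition linform v : poly3 := \sum_j v 0 j *: var j.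

(** Applying D_v amounts to multiplying by the form v . X, so composition of operators becomes a
    product in a commutative ring. *)
Lemma symbol_evalM_linform f x v p : smooth f ->
  symbol_eval f x (linform v * p) = symbol_eval (dirD v f) x p.
Proof.
move=> hf; rewrite /linform mulr_suml symbol_eval_sum.
have -> : \sum_j symbol_eval f x (v 0 j *: var j * p) =
    \sum_j v 0 j * symbol_eval (partial j f) x p.
  by apply: eq_bigr => j _; rewrite -scalerAl symbol_evalZ symbol_evalMvar.
elim/mpoly.mpolyind: p => [|c k p _ _ IH].
  by rewrite big1 => [|j _]; rewrite symbol_eval0 ?mulr0.
rewrite symbol_evalD -IH symbol_evalX partials_dirD //.
rewrite (dirD_coord v (smooth_partials k hf)) mulr_sumr -big_split /=.
apply: eq_bigr => j _; rewrite symbol_evalD symbol_evalX partials_dirD //.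
by rewrite mulrDr mulrCA.
Qed.

Lemma symbol_eval1 f x : symbol_eval f x 1 = f x.
Proof.
rewrite -[1]scale1r -mpoly.mpolyX0 symbol_evalX mul1r /partials.
by rewrite !mpoly.mnm0E.
Qed.

(** The free factor [p] carries the induction: peeling off one derivative multiplies [p] by the
    corresponding linear form. *)
Lemma symbol_eval_comp m (u : 'I_m -> 'rV[R]_3) (s : seq 'I_m) (P : pred 'I_m) f x p :
  smooth f ->
  smooth ((\big[comp/id]_(i <- s | P i) dirD (u i)) f) /\
  symbol_eval ((\big[comp/id]_(i <- s | P i) dirD (u i)) f) x p =
  symbol_eval f x (p * \prod_(i <- s | P i) linform (u i)).
Proof.
move=> hf; elim: s p => [|i s IH] p; first by rewrite !big_nil mulr1.
rewrite !big_cons; case: (P i) => //; have [sm _] := IH 0.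
split; first exact: smooth_dirD.
rewrite /= -symbol_evalM_linform //; have [_ ->] := IH (linform (u i) * p).
by rewrite mulrCA mulrA.
Qed.

Lemma elem_symE m (u : 'I_m -> 'rV[R]_3) r f x : smooth f ->
  elem_sym r (fun i => dirD (u i)) f x =
  symbol_eval f x (elsym r (fun i => linform (u i))).
Proof.
move=> hf; rewrite /elem_sym /elsym symbol_eval_sum; apply: eq_bigr => S _.
have [_] := symbol_eval_comp u (index_enum _) (mem S) x 1 hf.
by rewrite symbol_eval1 mul1r.
Qed.

Definition normsq : poly3 := \sum_j var j ^+ 2.

Lemma laplacianE f x : smooth f -> laplacian f x = symbol_eval f x normsq.
Proof.
move=> hf; rewrite /normsq symbol_eval_sum; apply: eq_bigr => j _.
rewrite expr2 -[var j * var j]mulr1 -mulrA !symbol_evalMvar ?symbol_eval1 //.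
exact: smooth_dirD.
Qed.

Lemma laplacian2E f x : smooth f ->
  laplacian (laplacian f) x = symbol_eval f x (normsq ^+ 2).
Proof.
move=> hf; have sj j : smooth (partial j (partial j f)).
  by do 2!apply: smooth_dirD.
have lapE : laplacian f = \sum_j partial j (partial j f).
  by apply/funext => y; rewrite fct_sumE.
have dsum (g : 'I_3 -> 'rV[R]_3 -> R) v : (forall j, smooth (g j)) ->
    dirD v (\sum_j g j) = \sum_j dirD v (g j).
  move=> hg; apply/funext => y; rewrite /dirD derive_sum ?fct_sumE // => j.
  by apply: diff_derivable; exact: smooth_differentiable.
have lapj j : partial j (partial j (laplacian f)) =
    \sum_k partial j (partial j (partial k (partial k f))).
  rewrite lapE; transitivity (partial j (\sum_k partial j (partial k (partial k f)))).
    by congr (partial j _); exact: (dsum (fun k => partial k (partial k f)) _ sj).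
  apply: (dsum (fun k => partial j (partial k (partial k f)))) => k.
  by apply: smooth_dirD; exact: sj.
rewrite expr2 {1}/normsq mulr_suml symbol_eval_sum; apply: eq_bigr => j _.
rewrite -/(partial j (partial j (laplacian f)) x) lapj fct_sumE.
rewrite expr2 -mulrA !symbol_evalMvar //; last exact: smooth_dirD.
rewrite -laplacianE; last exact: sj.
apply: eq_bigr => k _.
exact: (congr1 (fun g => g x) (dirD2C (delta_mx 0 j) (delta_mx 0 k) hf)).
Qed.

Lemma linform_sum m (u : 'I_m -> 'rV[R]_3) :
  psum 1 (fun i => linform (u i)) = linform (\sum_i u i).
Proof.
rewrite /psum /linform exchange_big /=; apply: eq_bigr => j _.
by rewrite summxE scaler_suml.
Qed.

Lemma linformE v : linform v = mpoly.mpolyC 3 (v 0 0) * var 0 +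
  mpoly.mpolyC 3 (v 0 1) * var 1 + mpoly.mpolyC 3 (v 0 2%:R) * var 2%:R.
Proof.
rewrite /linform !big_ord_recl big_ord0 addr0 addrA !mpoly.mul_mpolyC.
by do 2?congr (_ + _); congr (v 0 _ *: var _); apply: val_inj.
Qed.

Lemma normsqE : normsq = var 0 ^+ 2 + var 1 ^+ 2 + var 2%:R ^+ 2.
Proof.
rewrite /normsq !big_ord_recl big_ord0 addr0 addrA.
by do 2?congr (_ + _); congr (var _ ^+ 2); apply: val_inj.
Qed.

(** The coefficients of the sum of squares are the second moments on coordinate vectors. *)
Lemma psum2_linform m (u : 'I_m -> 'rV[R]_3) (c : R) :
  (forall x y, \sum_i dotv (u i) x * dotv (u i) y = c * dotv x y) ->
  psum 2 (fun i => linform (u i)) = c *: normsq.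
Proof.
move=> hc; rewrite /psum -mpoly.mul_mpolyC normsqE.
pose K : R -> poly3 := @mpoly.mpolyC 3 R.
have S j k : \sum_i K (u i 0 j) * K (u i 0 k) = K (c * (j == k)%:R).
  have := hc (delta_mx 0 j) (delta_mx 0 k); rewrite dotv_delta mxE eqxx eq_sym /= => <-.
  rewrite /K raddf_sum; apply: eq_bigr => i _; by rewrite /= !dotv_delta mpoly.mpolyCM.
have -> : \sum_i linform (u i) ^+ 2 =
    var 0 ^+ 2 * (\sum_i K (u i 0 0) * K (u i 0 0))
    + var 1 ^+ 2 * (\sum_i K (u i 0 1) * K (u i 0 1))
    + var 2%:R ^+ 2 * (\sum_i K (u i 0 2%:R) * K (u i 0 2%:R))
    + 2 * var 0 * var 1 * (\sum_i K (u i 0 0) * K (u i 0 1))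
    + 2 * var 0 * var 2%:R * (\sum_i K (u i 0 0) * K (u i 0 2%:R))
    + 2 * var 1 * var 2%:R * (\sum_i K (u i 0 1) * K (u i 0 2%:R)).
  rewrite !mulr_sumr -!big_split /=; apply: eq_bigr => i _.
  by rewrite linformE -!/(K _); ring.
have K0 : K 0 = 0 by exact: mpoly.mpolyC0.
rewrite !S /= !(mulr0, mulr1) -/(K c) ?K0; ring.
Qed.

(** The coefficients are fourth moments on coordinate vectors; the 3 counts the pairings of four
    equal indices. *)
Lemma psum4_linform m (u : 'I_m -> 'rV[R]_3) (c : R) :
  (forall x y z w, moment4 u x y z w =
    c * (dotv x y * dotv z w + dotv x z * dotv y w + dotv x w * dotv y z)) ->
  psum 4 (fun i => linform (u i)) = (3 * c) *: normsq ^+ 2.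
Proof.
move=> hc; rewrite /psum -mpoly.mul_mpolyC normsqE.
pose K : R -> poly3 := @mpoly.mpolyC 3 R.
pose d (j k : 'I_3) : R := (k == j)%:R.
have S j k l n : \sum_i K (u i 0 j) * K (u i 0 k) * (K (u i 0 l) * K (u i 0 n)) =
    K (c * (d j k * d l n + d j l * d k n + d j n * d k l)).
  have := hc (delta_mx 0 j) (delta_mx 0 k) (delta_mx 0 l) (delta_mx 0 n).
  rewrite /d !dotv_delta !mxE !eqxx /= => <-.
  by rewrite /K raddf_sum; apply: eq_bigr => i _; rewrite /= !dotv_delta !mpoly.mpolyCM.
pose Z j k l n := \sum_i K (u i 0 j) * K (u i 0 k) * (K (u i 0 l) * K (u i 0 n)).
pose X := var 0; pose Y := var 1; pose W := var 2%:R.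
have -> : \sum_i linform (u i) ^+ 4 =
    X ^+ 4 * Z 0 0 0 0 + 4 * X ^+ 3 * Y * Z 0 0 0 1 + 4 * X ^+ 3 * W * Z 0 0 0 2%:R
    + 6 * X ^+ 2 * Y ^+ 2 * Z 0 0 1 1 + 12 * X ^+ 2 * Y * W * Z 0 0 1 2%:R
    + 6 * X ^+ 2 * W ^+ 2 * Z 0 0 2%:R 2%:R + 4 * X * Y ^+ 3 * Z 0 1 1 1
    + 12 * X * Y ^+ 2 * W * Z 0 1 1 2%:R + 12 * X * Y * W ^+ 2 * Z 0 1 2%:R 2%:R
    + 4 * X * W ^+ 3 * Z 0 2%:R 2%:R 2%:R + Y ^+ 4 * Z 1 1 1 1
    + 4 * Y ^+ 3 * W * Z 1 1 1 2%:R + 6 * Y ^+ 2 * W ^+ 2 * Z 1 1 2%:R 2%:R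
    + 4 * Y * W ^+ 3 * Z 1 2%:R 2%:R 2%:R + W ^+ 4 * Z 2%:R 2%:R 2%:R 2%:R.
  rewrite /Z !mulr_sumr -!big_split /=; apply: eq_bigr => i _.
  by rewrite linformE -!/(K _) -!/X -!/Y -!/W; ring.
have K0 : K 0 = 0 by exact: mpoly.mpolyC0.
have K3 : K (c * (1 + 1 + 1)) = 3 * K c.
  have -> : c * (1 + 1 + 1) = c *+ 3 by ring.
  by rewrite /K raddfMn mulr_natl.
rewrite /Z !S /d /= !(mulr0, mul0r, mulr1, addr0, add0r) !K3 ?K0 -!/(K _).
rewrite [K (3 * c)](_ : _ = 3 * K c); last by rewrite -K3; congr K; ring.
rewrite -/X -/Y -/W; ring.
Qed.

Lemma poly3_half (p q : poly3) (n : nat) (c : R) : (0 < n)%N ->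
  n%:R * p = c *: q -> p = (c / n%:R) *: q.
Proof.
move=> n0; rewrite mulr_natl -scaler_nat => h.
by rewrite mulrC -scalerA -h scalerA mulVf ?scale1r // pnatr_eq0 -lt0n.
Qed.

End PolynomialAction.

(** * Platonic solids *)


Section PlatonicOperators.
Context {R : realType} {m : nat}.
Implicit Types (u : 'I_m -> 'rV[R]_3).

Lemma platonic_norm u p q : (0 < m)%N -> (0 < q)%N -> platonic_solid u p q ->
  forall i j, dotv (u i) (u i) = dotv (u j) (u j).
Proof.
move=> m0 q0 [[hu trans] [_ faces_q] cu] i j.
have flag k : exists E F, is_flag u k E F.
  have [F] : exists F, F \in [set F : {set 'I_m} | `[< face_of_dim u 2 F >] & k \in F].
    by apply/card_gt0P; rewrite faces_q.
  rewrite inE => /andP[/asboolP hF kF].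
  by have [E [_ [fl _ _]]] := two_edges hu hF kF; exists E, F.
have [[E [F fl]] [E' [F' fl']]] := (flag i, flag j).
have [s [/(is_symmetry_linear m0 cu)[Q [oQ hs]] sij _ _]] := trans _ _ _ _ _ _ fl fl'.
by rewrite -sij hs dotv_orth.
Qed.

Lemma platonic_frame u p q : (0 < m)%N -> (0 < q)%N -> platonic_solid u p q ->
  exists n0 n1 n2, [/\ root_frame u n0 n1 n2,
    coxeter_rel p (dotv n0 n1 ^+ 2), coxeter_rel q (dotv n1 n2 ^+ 2),
    dotv n0 n1 != 0 & dotv n1 n2 != 0].
Proof.
move=> m0 q0 hu.
have [s0 [s1 [s2 [Q0 [Q1 [Q2 [n0 [n1 [n2]]]]]]]]] := platonic_reflections m0 q0 hu.
move=> [[[_ l0] [_ l1] [_ l2]] [[[nn0 r0] [nn1 r1] [nn2 r2]] [n02 hp hq [n01 n12] indep]]].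
exists n0, n1, n2; split=> //; split=> //; split; split=> //.
- by exists s0 => i; rewrite l0 r0.
- by exists s1 => i; rewrite l1 r1.
- by exists s2 => i; rewrite l2 r2.
Qed.

(** Put c = a + b - 3 in the relation f^3 = c f^2 + c f - 1 for the product f of the reflections.
    Without a 5 in the symbol c = 0 and f^3 = -1; with a 5, c^2 = 1 - c and f^5 = -1. *)
Lemma platonic_central u p q : (0 < m)%N -> platonic_solid u p q ->
  (p, q) \in [:: (3, 4); (4, 3); (3, 5); (5, 3)] ->
  exists s : {perm 'I_m}, forall i, u (s i) = - u i.
Proof.
move=> m0 hu pq; have q0 : (0 < q)%N by move: pq; rewrite !inE => /or4P[]/eqP[_ ->].
have [s0 [s1 [s2 [Q0 [Q1 [Q2 [n0 [n1 [n2]]]]]]]]] := platonic_reflections m0 q0 hu.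
move=> [[[_ l0] [_ l1] [_ l2]] [[r0 r1 r2] [n02 hp hq _ indep]]].
pose f (v : 'rV[R]_3) := v *m Q0 *m Q1 *m Q2.
have [s fs] : exists s : {perm 'I_m}, forall i, u (s i) = f (u i).
  by exists (s0 * s1 * s2)%g => i; rewrite !permM l2 l1 l0.
have fN (v w : 'rV[R]_3) : f (v - w) = f v - f w by rewrite /f !mulmxBl.
have fZ c (v : 'rV[R]_3) : f (c *: v) = c *: f v by rewrite /f -!scalemxAl.
have fD (v w : 'rV[R]_3) : f (v + w) = f v + f w by rewrite /f !mulmxDl.
have ch x := coxeter_cayley_hamilton x r0 r1 r2 n02 indep.
move: ch hp hq; set a := dotv n0 n1 ^+ 2; set b := dotv n1 n2 ^+ 2 => /= ch hp hq.
have [c0|cc] : a + b - 3 = 0 \/ (a + b - 3) ^+ 2 = 1 - (a + b - 3).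
  move: pq hp hq; rewrite !inE => /or4P[]/eqP[-> ->] /= hp hq.
  - by left; rewrite hp hq; ring.
  - by left; rewrite hp hq; ring.
  - by right; rewrite hp; lra.
  - by right; rewrite hq; lra.
- exists (s * s * s)%g => i; rewrite !permM !fs /f ch c0 !scale0r !add0r.
  by [].
- exists (s * s * s * s * s)%g => i; rewrite !permM !fs.
  have ch' x : f (f (f x)) = (a + b - 3) *: f (f x) + (a + b - 3) *: f x - x by exact: ch.
  move: (a + b - 3) cc ch' => c cc ch'.
  rewrite (ch' (u i)) !(fN, fD, fZ) (ch' (u i)) !(fN, fD, fZ) ch'.
  move: (f (f (u i))) (f (u i)) (u i) => x y z; apply/rowP => j; rewrite !mxE.
  by ring: cc.
Qed.

Lemma platonic_e2 u p q : (1 < m)%N -> (0 < q)%N -> platonic_solid u p q ->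
  exists c : R, [/\ c != 0,
    forall x y, \sum_i dotv (u i) x * dotv (u i) y = c * dotv x y &
    op_proportional (elem_sym 2 (fun i => dirD (u i))) laplacian].
Proof.
move=> m1 q0 hu; have m0 : (0 < m)%N by apply: ltn_trans m1.
have [n0 [n1 [n2 [fr _ _ n01 n12]]]] := platonic_frame m0 q0 hu.
have [c hc] := second_moment fr n01 n12; have [[hv _] _ cu] := hu.
(* A zero constant would put every vertex at the origin, but vertices are distinct. *)
have c0 : c != 0.
  apply/eqP => c0; have u0 k : u k = 0.
    have := hc (u k) (u k); rewrite c0 mul0r => /psumr_eq0P-h.
    apply/eqP; rewrite -dotv_eq0 -sqrf_eq0 expr2 h // => i _.
    by rewrite -expr2 sqr_ge0.
  have := @vertex_inj _ _ _ (Ordinal m0) (Ordinal m1) hv; rewrite !u0 => /(_ erefl).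
  by move/(congr1 val).
exists c; split=> //; exists (- c / 2); split=> [|f hf x].
  by rewrite mulf_neq0 ?oppr_eq0 // invr_eq0 pnatr_eq0.
rewrite elem_symE // laplacianE // -symbol_evalZ; congr symbol_eval.
apply: (@poly3_half _ _ _ 2) => //; rewrite elsym2; last first.
  rewrite linform_sum cu /linform big1 // => j _; by rewrite mxE scale0r.
by rewrite (psum2_linform hc) scaleNr.
Qed.

Lemma linformN (v : 'rV[R]_3) : linform (- v) = - linform v.
Proof. by rewrite /linform -sumrN; apply: eq_bigr => j _; rewrite mxE scaleNr. Qed.

Lemma poly3_double (p : mpoly.mpoly 3 R) : p + p = 0 -> p = 0.
Proof.
by move=> pp; rewrite (@poly3_half _ p 0 2 0) ?scaler0 // mulr_natl mulr2n pp.
Qed.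

Lemma central_psum3 u (s : {perm 'I_m}) : (forall i, u (s i) = - u i) ->
  psum 3 (fun i => linform (u i)) = 0.
Proof.
move=> hs; apply: poly3_double; rewrite {1}/psum (reindex_inj (@perm_inj _ s)) /=.
rewrite -big_split big1 //= => i _; rewrite hs linformN; ring.
Qed.

Lemma central_elem_sym_odd u (s : {perm 'I_m}) r : odd r ->
  (forall i, u (s i) = - u i) -> op_zero (elem_sym r (fun i => dirD (u i))).
Proof.
move=> r_odd hs f hf x; rewrite elem_symE // (@elsym_odd_eq0 _ _ _ _ s) ?symbol_eval0 //.
  exact: poly3_double.
by move=> i; rewrite hs linformN.
Qed.

Lemma platonic_odd u p q r : (0 < m)%N -> platonic_solid u p q ->
  (p, q) \in [:: (3, 4); (4, 3); (3, 5); (5, 3)] -> odd r ->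
  op_zero (elem_sym r (fun i => dirD (u i))).
Proof.
move=> m0 hu pq r_odd; have [s hs] := platonic_central m0 hu pq.
exact: central_elem_sym_odd hs.
Qed.

(** Newton's identity gives the constant (c^2 - 6 d) / 8 from the second and fourth moments. That it
    is nonzero follows by taking traces, all vertices having the same norm. *)
Lemma platonic_e4 u p q : (3 < m)%N -> platonic_solid u p q ->
  (p, q) \in [:: (3, 5); (5, 3)] ->
  op_proportional (elem_sym 4 (fun i => dirD (u i))) (laplacian \o laplacian).
Proof.
move=> m4 hu pq; have m1 : (1 < m)%N by apply: leq_trans m4.
have m0 : (0 < m)%N by apply: leq_trans m4.
have q0 : (0 < q)%N by move: pq; rewrite !inE => /orP[]/eqP[_ ->].
have pq' : (p, q) \in [:: (3, 4); (4, 3); (3, 5); (5, 3)].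
  by move: pq; rewrite !inE => ->; rewrite !orbT.
have [c [c0 hc _]] := platonic_e2 m1 q0 hu.
have [s hs] := platonic_central m0 hu pq'.
have [n0 [n1 [n2 [fr hp hq n01 n12]]]] := platonic_frame m0 q0 hu.
(* The roots of b^2 - 3 b + 1 avoid 1 and 2, as [fourth_moment] requires. *)
have gold (a b : R) : a = 1 -> b ^+ 2 - 3 * b + 1 = 0 ->
    [/\ a != 2, b != 2 & b != 1].
  by move=> -> hb; split; apply/eqP => h; [lra | rewrite h in hb; lra | rewrite h in hb; lra].
have [h1 h2 h3] : [/\ dotv n0 n1 ^+ 2 != 2, dotv n1 n2 ^+ 2 != 2 &
    (dotv n0 n1 ^+ 2 != 1) || (dotv n1 n2 ^+ 2 != 1)].
  move: pq hp hq; rewrite !inE => /orP[]/eqP[-> ->] /= hp hq.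
    by have [-> -> ->] := gold _ _ hp hq; rewrite orbT.
  by have [-> -> ->] := gold _ _ hq hp.
have [d hd] := fourth_moment fr n01 n12 h1 h2 h3.
pose rho := dotv (u (Ordinal m0)) (u (Ordinal m0)).
have urho i : dotv (u i) (u i) = rho by apply: platonic_norm m0 q0 hu _ _.
have dd (j k : 'I_3) : dotv (delta_mx 0 j : 'rV[R]_3) (delta_mx 0 k) = (k == j)%:R.
  by rewrite dotv_delta mxE eqxx.
have trace2 : rho * m%:R = 3 * c.
  have : \sum_i dotv (u i) (u i) = \sum_(j < 3) c * 1.
    under eq_bigr do rewrite dotvE; rewrite exchange_big; apply: eq_bigr => j _ /=.
    have := hc (delta_mx 0 j) (delta_mx 0 j); rewrite dd eqxx => <-.
    by apply: eq_bigr => i _; rewrite !dotv_delta.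
  rewrite (eq_bigr (fun=> rho)) => [|i _]; last exact: urho.
  by rewrite !sumr_const !card_ord mulr1 mulr_natr => ->; rewrite mulr_natl.
(* The double sum has nine terms d and three diagonal corrections 2 d, whence 15. *)
have trace4 : rho * rho * m%:R = 15 * d.
  have : \sum_i dotv (u i) (u i) * dotv (u i) (u i) =
      \sum_(j < 3) \sum_(k < 3) d * (1 + (k == j)%:R + (k == j)%:R).
    under eq_bigr do rewrite dotvE big_distrlr /=.
    rewrite exchange_big; apply: eq_bigr => j _ /=.
    rewrite exchange_big; apply: eq_bigr => k _ /=.
    have := hd (delta_mx 0 j) (delta_mx 0 j) (delta_mx 0 k) (delta_mx 0 k).
    rewrite !dd !eqxx mulr1 => E.
    transitivity (moment4 u (delta_mx 0 j) (delta_mx 0 j) (delta_mx 0 k) (delta_mx 0 k)).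
      by apply: eq_bigr => i _; rewrite !dotv_delta.
    by rewrite E; case: (k == j); rewrite ?mulr0 ?mulr1.
  rewrite (eq_bigr (fun=> rho * rho)) => [|i _]; last by rewrite urho.
  rewrite sumr_const card_ord mulr_natr => ->; rewrite !big_ord_recl !big_ord0 /=; ring.
exists ((c ^+ 2 - 2 * (3 * d)) / 8); split=> [|f hf x].
  rewrite mulf_neq0 ?invr_eq0 ?pnatr_eq0 //; apply/eqP => E.
  have M4 : 4 <= m%:R :> R by rewrite ler_nat.
  move: M4 trace2 trace4; move: (m%:R : R) => M M4 t2 t4.
  have rho0 : rho != 0.
    apply: contra c0 => /eqP r0; move: t2; rewrite r0 mul0r => /esym/eqP.
    by rewrite mulf_eq0 pnatr_eq0.
  (* With both traces, c^2 = 6 d would force 5 m = 18, impossible for m at least 4. *)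
  have : rho ^+ 2 * M * (5 * M - 18) = 0.
    have -> : rho ^+ 2 * M * (5 * M - 18) = 5 * (rho * M) ^+ 2 - 18 * (rho * rho * M) by ring.
    by rewrite t2 t4; lra.
  by move/eqP; apply/negP; rewrite !mulf_neq0 //; apply/eqP => h; lra.
rewrite /= laplacian2E // elem_symE // -symbol_evalZ; congr symbol_eval.
apply: (@poly3_half _ _ _ 8) => //; rewrite elsym4; last exact: central_psum3 hs.
  rewrite (psum2_linform hc) (psum4_linform hd) exprZn.
  by rewrite mulr_natl -scaler_nat scalerA -scalerBl.
have [_ _ cu] := hu.
by rewrite linform_sum cu /linform big1 // => j _; rewrite mxE scale0r.
Qed.

End PlatonicOperators.

Theorem mainTheorem4 (R : realType) :
  (forall u : 'I_4 -> 'rV[R]_3, tetrahedron u ->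
     op_zero (elem_sym 1 (fun i => dirD (u i))) /\
     op_proportional (elem_sym 2 (fun i => dirD (u i))) laplacian) /\
  (forall u : 'I_6 -> 'rV[R]_3, octahedron u ->
     op_proportional (elem_sym 2 (fun i => dirD (u i))) laplacian /\
     (forall k : nat, (1 <= k <= 3)%N ->
        op_zero (elem_sym (6 - 2 * k + 1)%N (fun i => dirD (u i))))) /\
  (forall u : 'I_8 -> 'rV[R]_3, cube u ->
     op_proportional (elem_sym 2 (fun i => dirD (u i))) laplacian /\
     (forall k : nat, (1 <= k <= 4)%N ->
        op_zero (elem_sym (8 - 2 * k + 1)%N (fun i => dirD (u i))))) /\
  (forall u : 'I_12 -> 'rV[R]_3, icosahedron u ->
     op_proportional (elem_sym 2 (fun i => dirD (u i))) laplacian /\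
     op_proportional (elem_sym 4 (fun i => dirD (u i)))
       (laplacian \o laplacian) /\
     (forall k : nat, (1 <= k <= 6)%N ->
        op_zero (elem_sym (12 - 2 * k + 1)%N (fun i => dirD (u i))))) /\
  (forall u : 'I_20 -> 'rV[R]_3, dodecahedron u ->
     op_proportional (elem_sym 2 (fun i => dirD (u i))) laplacian /\
     op_proportional (elem_sym 4 (fun i => dirD (u i)))
       (laplacian \o laplacian) /\
     (forall k : nat, (1 <= k <= 10)%N ->
        op_zero (elem_sym (20 - 2 * k + 1)%N (fun i => dirD (u i))))).
Proof.
(* The bound on [k] makes the truncated subtraction exact, so its parity can be read off. *)
have odd_index n k : ~~ odd n -> (1 <= k <= n./2)%N -> odd (n - 2 * k + 1).
  move=> n_even /andP[_ kn]; rewrite addn1 /= oddB ?mul2n ?odd_double ?addbF //.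
  by rewrite -(even_halfK n_even) leq_double.
split; [|split; [|split; [|split]]] => u hu.
- have [c [_ _ e2]] := platonic_e2 (isT : (1 < 4)%N) (isT : (0 < 3)%N) hu.
  split=> [f hf x|]; last exact: e2.
  (* e_1 is the linear form of the sum of the vertices, which is 0. *)
  have [_ _ cu] := hu; rewrite elem_symE // elsym1 linform_sum cu /linform.
  rewrite big1 ?symbol_eval0 //.
  by move=> j _; rewrite mxE scale0r.
- have [c [_ _ e2]] := platonic_e2 (isT : (1 < 6)%N) (isT : (0 < 4)%N) hu.
  split=> [|k hk]; first exact: e2.
  exact: (platonic_odd _ hu) (odd_index 6 k isT hk).
- have [c [_ _ e2]] := platonic_e2 (isT : (1 < 8)%N) (isT : (0 < 3)%N) hu.
  split=> [|k hk]; first exact: e2.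
  exact: (platonic_odd _ hu) (odd_index 8 k isT hk).
- have [c [_ _ e2]] := platonic_e2 (isT : (1 < 12)%N) (isT : (0 < 5)%N) hu.
  split; first exact: e2.
  split; first exact: (platonic_e4 _ hu).
  by move=> k hk; exact: (platonic_odd _ hu) (odd_index 12 k isT hk).
- have [c [_ _ e2]] := platonic_e2 (isT : (1 < 20)%N) (isT : (0 < 3)%N) hu.
  split; first exact: e2.
  split; first exact: (platonic_e4 _ hu).
  by move=> k hk; exact: (platonic_odd _ hu) (odd_index 20 k isT hk).
Qed.
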